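(* Let $\mathbf v=(\mathrm v_0,\dots,\mathrm v_{l-1})\in\mathcal V_l$ and $\Lambda=\Lambda_{\overline{\mathrm v_0}}+\cdots+\Lambda_{\overline{\mathrm v_{l-1}}}$. Then the crystal embedding $\Phi(\mathbf v)\hookrightarrow B(\infty)\otimes T_\Lambda$ is given by $$\boldsymbol\lambda\mapsto f_{\mathbf v}(\boldsymbol\lambda)\otimes t_\Lambda,$$ where $f_{\mathbf v}(\boldsymbol\lambda)$ is the multisegment consisting of the segments $[1-j+\mathrm v_c;\lambda^{(c)}_j)$, one for each $0\le c\le l-1$ and each nonzero part $\lambda_j^{(c)}$ of $\lambda^{(c)}$.
   Context: $e\ge2$ is an integer, $\mathfrak g$ is the Kac–Moody algebra of type $A^{(1)}_{e-1}$, with simple coroots $\alpha_i^\vee$, simple roots $\alpha_i$ and fundamental weights $\Lambda_i$, $i\in\mathbb Z/e\mathbb Z$. $\bar x$ denotes the class of $x\in\mathbb Z$ in $\mathbb Z/e\mathbb Z$. $\mathcal V_l=\{(\mathrm v_0,\dots,\mathrm v_{l-1})\in\mathbb Z^l\mid \mathrm v_0\le\mathrm v_1\le\cdots\le\mathrm v_{l-1}<\mathrm v_0+e\}$. **Crystal of $l$-partitions.** An $l$-partition is $\boldsymbol\lambda=(\lambda^{(0)},\dots,\lambda^{(l-1)})$. A node $\gamma=(a,b,c)$ (row $a$, column $b$, component $c$) has content $c(\gamma)=b-a+\mathrm v_c\in\mathbb Z$ and residue $\overline{c(\gamma)}$; it is an $i$-node if its residue is $i$. Addable and removable nodes are as usual.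 Order $i$-nodes by: $\gamma_1=(a_1,b_1,c_1)\prec_{\mathbf v}\gamma_2=(a_2,b_2,c_2)$ iff $c(\gamma_1)<c(\gamma_2)$, or $c(\gamma_1)=c(\gamma_2)$ and $c_1>c_2$. Read the addable (A) and removable (R) $i$-nodes of $\boldsymbol\lambda$ in increasing order and recursively delete consecutive pairs $RA$ as many times as possible. If a removable node remains, $\tilde e_i\boldsymbol\lambda$ is obtained by removing the leftmost remaining removable node; otherwise $\tilde e_i\boldsymbol\lambda=0$. If an addable node remains, $\tilde f_i\boldsymbol\lambda$ is obtained by adding the rightmost remaining addable node; otherwise $\tilde f_i\boldsymbol\lambda=0$. Put $\mathrm{wt}(\boldsymbol\lambda)=\Lambda-\sum_iN_i(\boldsymbol\lambda)\alpha_i$, with $N_i(\boldsymbol\lambda)$ the number of $i$-nodes, $\epsilon_i(\boldsymbol\lambda)=\max\{k\mid\tilde e_i^k\boldsymbol\lambda\ne0\}$, $\varphi_i(\boldsymbol\lambda)=\max\{k\mid\tilde f_i^k\boldsymbol\lambda\ne0\}$. $B(\mathbf v)$ is the connected component of the empty $l$-partition $\boldsymbol\emptyset$; it is isomorphic to the highest weight crystal $B(\Lambda)$. **FLOTW $l$-partitions.** For $\mathbf v\in\mathcal V_l$, $\Phi(\mathbf v)$ is the set of $l$-partitions with (i) $\lambda_j^{(c)}\ge\lambda^{(c+1)}_{j+\mathrm v_{c+1}-\mathrm v_c}$ for $0\le c\le l-2$ and $\lambda_j^{(l-1)}\ge\lambda^{(0)}_{j+e+\mathrm v_0-\mathrm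 v_{l-1}}$, for all $j\ge 1$; (ii) for each $k>0$, the set of residues $\overline{k-j+\mathrm v_c}$ over all $(j,c)$ with $\lambda_j^{(c)}=k$ is not all of $\mathbb Z/e\mathbb Z$. It is known that $\Phi(\mathbf v)=B(\mathbf v)$, so $\Phi(\mathbf v)$ carries the crystal structure on $l$-partitions given by the maps $\mathrm{wt},\epsilon_i,\varphi_i$ and the operators $\tilde e_i,\tilde f_i$ defined by the order $\prec_{\mathbf v}$ and the deletion of pairs $RA$. **$B(\infty)$.** For $i\in\mathbb Z/e\mathbb Z$, $k\ge1$, $[i;k)$ is the segment $[i,i+1,\dots,i+k-1]$ and $(k;i]$ is the segment $[i-k+1,\dots,i]$ of residues. A multisegment is a finite collection with multiplicities of segments; it is aperiodic if for every $k\ge 1$ some $[i;k)$ does not occur. $B(\infty)$ (the crystal of the negative half of $U_v(\mathfrak g)$) is identified with the set of aperiodic multisegments with the following crystal structure: with $m_{(k;i]}$ the multiplicity of $(k;i]$ in $\psi$, $S_{k,i}=\sum_{r\ge k}(m_{(r;i-1]}-m_{(r;i]})$ and $\ell_0$ the smallest $k\ge 1$ attaining $\min_{k>0}S_{k,i}$, $\tilde f_i\psi$ is obtained by adding $(1;i]$ if $\ell_0=1$ and replacing one $(\ell_0-1;i-1]$ with $(\ell_0;i]$ if $\ell_0>1$; $\tilde e_i\psi=\psi'$ if $\tilde f_i\psi'=\psi$ and $0$ if there is no such $\psi'$; the weight of $\psi$ is minus the sum of $\alpha_i$ over all residues occurring in $\psi$; $\epsilon_i(\psi)=\max\{k\mid\tilde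 e_i^k\psi\neq0\}$ and $\varphi_i(\psi)=\epsilon_i(\psi)+\mathrm{wt}(\psi)(\alpha_i^\vee)$. **Embedding.** $T_\Lambda=\{t_\Lambda\}$ is the crystal with $\mathrm{wt}(t_\Lambda)=\Lambda$, $\epsilon_i(t_\Lambda)=\varphi_i(t_\Lambda)=-\infty$, $\tilde e_it_\Lambda=\tilde f_it_\Lambda=0$; tensor products are Kashiwara's, so $\tilde e_i,\tilde f_i$ act on the first factor of $B(\infty)\otimes T_\Lambda$. A crystal embedding is an injective map preserving $\mathrm{wt},\epsilon_i,\varphi_i$, commuting with $\tilde e_i$, and commuting with $\tilde f_i$ on elements $b$ of the source with $\tilde f_ib\ne0$. ''The crystal embedding'' is the unique one; it sends $\boldsymbol\emptyset$ to $\emptyset\otimes t_\Lambda$, with $\emptyset$ the empty multisegment. *)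

(* Defs.v *)
From HB Require Import structures.
From mathcomp Require Import all_boot all_order all_algebra.
From mathcomp Require Import finmap multiset ring.
From mathcomp Require Import boolp classical_sets constructive_ereal.
Set Implicit Arguments.
Unset Strict Implicit.
Unset Printing Implicit Defensive.
Import Order.TTheory GRing.Theory Num.Theory.
Local Open Scope mset_scope.
Local Open Scope ring_scope.

(* The weight sum_i a_i Lambda_i + d delta is the pair (a, d).  The delta
   component matters: it makes the simple roots linearly independent.        *)
Definition weight (e : nat) := ({ffun 'Z_e -> int} * int)%type.

Definition pairing e (w : weight e) (i : 'Z_e) : int := w.1 i.

Definition fund_weight e (i : 'Z_e) : weight e := ([ffun j => (j == i)%:R], 0).

(* alpha_i = 2 Lambda_i - Lambda_(i-1) - Lambda_(i+1), plus delta if i = 0;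
   for e = 2 the last two fundamental weights coincide.                      *)
Definition simple_root e (i : 'Z_e) : weight e :=
  ([ffun j => 2 * (j == i)%:R - (j == i - 1)%:R - (j == i + 1)%:R],
   (i == 0)%:R).

(* Structure maps only: the notion of embedding does not involve the crystal
   axioms.  [None] is the element 0; eps and phi take values in Z and -oo.   *)
Record crystal (e : nat) := Crystal {
  carrier :> Type;
  wt : carrier -> weight e;
  eps : 'Z_e -> carrier -> \bar int;
  phi : 'Z_e -> carrier -> \bar int;
  et : 'Z_e -> carrier -> option carrier;
  ft : 'Z_e -> carrier -> option carrier }.

Record crystal_embedding e (B1 B2 : crystal e) (h : B1 -> B2) : Prop :=
  CrystalEmbedding {
    emb_inj : injective h;
    emb_wt : forall b, wt (h b) = wt b;
    emb_eps : forall i b, eps i (h b) = eps i b;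
    emb_phi : forall i b, phi i (h b) = phi i b;
    emb_et : forall i b, et i (h b) = omap h (et i b);
    emb_ft : forall i b b', ft i b = Some b' -> ft i (h b) = Some (h b') }.

Definition tensor e (B1 B2 : crystal e) : crystal e :=
  @Crystal e (B1 * B2)%type
    (fun b => wt b.1 + wt b.2)
    (fun i b => maxe (eps i b.1) (eps i b.2 - (pairing (wt b.1) i)%:E)%E)
    (fun i b => maxe (phi i b.2) (phi i b.1 + (pairing (wt b.2) i)%:E)%E)
    (fun i b => if (eps i b.2 <= phi i b.1)%E
                then omap (fun x => (x, b.2)) (et i b.1)
                else omap (fun y => (b.1, y)) (et i b.2))
    (fun i b => if (eps i b.2 < phi i b.1)%E
                then omap (fun x => (x, b.2)) (ft i b.1)
                else omap (fun y => (b.1, y)) (ft i b.2)).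

Definition T_crystal e (L : weight e) : crystal e :=
  @Crystal e unit (fun _ => L) (fun _ _ => -oo%E) (fun _ _ => -oo%E)
    (fun _ _ => None) (fun _ _ => None).

(* max {k | g^k x <> 0}; the default 0 is irrelevant, this maximum exists
   in all the uses below.                                                    *)
Definition max_iter (T : Type) (g : T -> option T) (x : T) : nat :=
  let nonzero k := iter k (obind g) (Some x) <> None in
  xget 0%N [set k | nonzero k /\ forall m, nonzero m -> (m <= k)%N].

(* Meant for a subset P stable under the operators, so that [insub] never
   turns a nonzero value into 0.                                             *)
Definition sub_crystal e (B : crystal e) (P : pred B) : crystal e :=
  @Crystal e {b : B | P b}
    (fun b => wt (val b))
    (fun i b => eps i (val b))
    (fun i b => phi i (val b))
    (fun i b => obind insub (et i (val b)))
    (fun i b => obind insub (ft i (val b))).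

Definition is_part (s : seq nat) := sorted geq s && (0%N \notin s).

Definition mpart (l : nat) := {t : l.-tuple (seq nat) | all is_part t}.

Definition mcomp l (la : mpart l) (c : nat) : seq nat := nth [::] (val la) c.

(* lambda^(c)_j for j >= 1; only such j are meaningful. *)
Definition part l (la : mpart l) (c : nat) (j : int) : nat :=
  if j is Posz j'.+1 then nth 0%N (mcomp la c) j' else 0%N.

(* The node (row, column, component); rows and columns start at 1, components
   at 0.                                                                     *)
Definition node := (nat * nat * nat)%type.

Definition in_diag l (la : mpart l) (g : node) : bool :=
  let: (a, b, c) := g in (0 < a)%N && (0 < b <= part la c a)%N.

Definition addable l (la : mpart l) (g : node) : bool :=
  let: (a, b, c) := g in
  [&& (0 < a)%N, (0 < b)%N, (c < l)%N, ~~ in_diag la (a, b, c),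
      (a == 1%N) || in_diag la (a.-1, b, c)
    & (b == 1%N) || in_diag la (a, b.-1, c)].

Definition removable l (la : mpart l) (g : node) : bool :=
  let: (a, b, c) := g in
  [&& in_diag la (a, b, c), ~~ in_diag la (a.+1, b, c)
    & ~~ in_diag la (a, b.+1, c)].

(* The filter only drops the last row when its only node is removed. *)
Definition set_part (s : seq nat) (a k : nat) : seq nat :=
  [seq x <- set_nth 0%N s a.-1 k | (0 < x)%N].

(* [insub] succeeds when this is used to add an addable node or to remove a
   removable one.                                                            *)
Definition set_row l (la : mpart l) (a c k : nat) : option (mpart l) :=
  insub [tuple (if c' == c :> nat then set_part (tnth (val la) c') a k
                else tnth (val la) c') | c' < l].

Definition add_node l (la : mpart l) (g : node) : option (mpart l) :=
  let: (a, b, c) := g in set_row la a c b.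

Definition remove_node l (la : mpart l) (g : node) : option (mpart l) :=
  let: (a, b, c) := g in set_row la a c b.-1.

(* A finite list containing all nodes of la and all addable nodes. *)
Definition box l (la : mpart l) : seq node :=
  flatten [seq [seq (a, b, c) | a <- iota 1 (size (mcomp la c)).+1,
                                b <- iota 1 (part la c 1).+1]
          | c <- iota 0 l].

Definition content (v : seq int) (g : node) : int :=
  let: (a, b, c) := g in b%:Z - a%:Z + v`_c.

Definition residue e (v : seq int) (g : node) : 'Z_e := (content v g)%:~R.

Definition prec (v : seq int) (g1 g2 : node) : bool :=
  (content v g1 < content v g2)
  || ((content v g1 == content v g2) && (g2.2 < g1.2)%N).

Definition ar_word e l (v : seq int) (la : mpart l) (i : 'Z_e) : seq node :=
  sort (fun g1 g2 => ~~ prec v g2 g1)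
    [seq g <- box la | (addable la g || removable la g) && (residue e v g == i)].

Fixpoint delete_RA (T : Type) (R A : pred T) (w : seq T) : seq T :=
  if w is x :: w1 then
    if w1 is y :: w2 then
      if R x && A y then w2 else x :: delete_RA R A w1
    else w
  else w.

(* Each pass deletes at most one pair, so [size w] passes delete them all. *)
Definition reduce_RA (T : Type) (R A : pred T) (w : seq T) : seq T :=
  iter (size w) (delete_RA R A) w.

Definition reduced_word e l v (la : mpart l) (i : 'Z_e) : seq node :=
  reduce_RA (removable la) (addable la) (ar_word v la i).

Definition mpart_et e l v (i : 'Z_e) (la : mpart l) : option (mpart l) :=
  obind (remove_node la)
    (ohead [seq g <- reduced_word v la i | removable la g]).

Definition mpart_ft e l v (i : 'Z_e) (la : mpart l) : option (mpart l) :=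
  obind (add_node la)
    (ohead (rev [seq g <- reduced_word v la i | addable la g])).

Definition node_count e l v (la : mpart l) (i : 'Z_e) : nat :=
  count (fun g => in_diag la g && (residue e v g == i)) (box la).

Definition Lambda e (v : seq int) : weight e :=
  \sum_(x <- v) fund_weight (x%:~R : 'Z_e).

Definition mpart_wt e l v (la : mpart l) : weight e :=
  Lambda e v - \sum_(i : 'Z_e) simple_root i *+ node_count v la i.

Definition mpart_crystal e l (v : l.-tuple int) : crystal e :=
  @Crystal e (mpart l) (@mpart_wt e l v)
    (fun i la => (max_iter (mpart_et v i) la)%:Z%:E)
    (fun i la => (max_iter (mpart_ft v i) la)%:Z%:E)
    (mpart_et v) (mpart_ft v).

Definition in_V e l (v : l.-tuple int) : Prop :=
  sorted <=%R v /\ last 0 v < head 0 v + e%:Z.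

Definition flotw e l (v : l.-tuple int) (la : mpart l) : Prop :=
  [/\ forall c (j : int), (c.+1 < l)%N -> 1 <= j ->
        (part la c.+1 (j + v`_c.+1 - v`_c) <= part la c j)%N,
      forall j : int, 1 <= j ->
        (part la 0 (j + e%:Z + v`_0 - v`_l.-1) <= part la l.-1 j)%N
    & forall k, (0 < k)%N ->
        ~ forall r : 'Z_e, exists (j : int) (c : nat),
            [/\ 1 <= j, (c < l)%N, part la c j = k
              & (k%:Z - j + v`_c)%:~R = r]].

(* For v in V_l this subset is the connected component of the empty
   l-partition, hence stable under the operators.                            *)
Definition Phi e l (v : l.-tuple int) : crystal e :=
  sub_crystal (B := mpart_crystal e v) (fun la => `[< flotw e v la >]).

(* [i; k) *)
Definition seg e (i : 'Z_e) (k : nat) : seq 'Z_e := mkseq (fun t => i + t%:R) k.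

(* (k; i] *)
Definition seg_to e (k : nat) (i : 'Z_e) : seq 'Z_e := seg (i - k%:R + 1) k.

Definition multisegment e (psi : {mset seq 'Z_e}) : Prop :=
  forall s, s \in psi -> exists i k, (0 < k)%N /\ s = seg i k.

Definition aperiodic e (psi : {mset seq 'Z_e}) : Prop :=
  multisegment psi /\
  forall k, (0 < k)%N -> exists i : 'Z_e, seg i k \notin psi.

Definition max_len e (psi : {mset seq 'Z_e}) : nat :=
  (\max_(s <- (psi : seq _)) size s)%N.

(* The terms with r > max_len psi vanish. *)
Definition Sval e (psi : {mset seq 'Z_e}) (i : 'Z_e) (k : nat) : int :=
  \sum_(k <= r < (max_len psi).+1)
    ((psi (seg_to r (i - 1)))%:Z - (psi (seg_to r i))%:Z).

(* Smallest k >= 1 minimizing S_(k, i); the range 1 <= k <= max_len psi + 1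
   suffices since S_(k, i) = 0 for k > max_len psi.                          *)
Definition ell0 e (psi : {mset seq 'Z_e}) (i : 'Z_e) : nat :=
  let ks := iota 1 (max_len psi).+1 in
  (find (fun k => all (fun k' => Sval psi i k <= Sval psi i k') ks) ks).+1.

Definition mseg_ft e (i : 'Z_e) (psi : {mset seq 'Z_e}) : {mset seq 'Z_e} :=
  let k := ell0 psi i in
  if k == 1%N then (psi `+` [mset seg_to 1 i])%mset
  else (psi `\` [mset seg_to k.-1 (i - 1)] `+` [mset seg_to k i])%mset.

Definition mseg_wt e (psi : {mset seq 'Z_e}) : weight e :=
  - \sum_(s <- (psi : seq _)) \sum_(i <- s) simple_root i.

Lemma size_seg e (i : 'Z_e) k : size (seg i k) = k.
Proof. by rewrite size_mkseq. Qed.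

Lemma seg_inj e (i j : 'Z_e) k : (0 < k)%N -> seg i k = seg j k -> i = j.
Proof.
move=> k0 /(congr1 (fun s => nth 0 s 0)).
by rewrite !nth_mkseq // !addr0.
Qed.

Lemma le_max_len e (psi : {mset seq 'Z_e}) s :
  s \in psi -> (size s <= max_len psi)%N.
Proof. by move=> sp; rewrite /max_len (leq_bigmax_seq (F := size)). Qed.

Lemma ell0P e (psi : {mset seq 'Z_e}) i k :
  (0 < k <= (max_len psi).+1)%N -> Sval psi i (ell0 psi i) <= Sval psi i k.
Proof.
rewrite /ell0; set ks := iota _ _; set p := fun k => all _ _ => kb.
have kks : k \in ks by rewrite mem_iota add1n ltnS.
pose F (x : 'I_(max_len psi).+1) := Sval psi i x.+1.
have hp : has p ks.
  have [x _ xmin] := @Order.TotalTheory.arg_minP _ _ _ ord0 xpredT F isT.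
  apply/hasP; exists (x : nat).+1.
    by rewrite mem_iota add1n ltnS; apply: (ltn_ord x).
  apply/allP => -[|y]; rewrite mem_iota add1n ltnS //= => yl.
  exact: (xmin (Ordinal (yl : (y < (max_len psi).+1)%N)) isT).
have fl : (find p ks < (max_len psi).+1)%N by move: hp; rewrite has_find size_iota.
have := nth_find 0%N hp; rewrite nth_iota // add1n.
by move=> /allP /(_ _ kks).
Qed.

(* The maps f_i preserve aperiodicity, hence are never 0 on B(infinity). *)
Lemma aperiodic_ft e (i : 'Z_e) (psi : {mset seq 'Z_e}) :
  aperiodic psi -> aperiodic (mseg_ft i psi).
Proof.
move=> [mpsi apsi]; set L := ell0 psi i.
have Lgt0 : (0 < L)%N by [].
have sub s : s \in mseg_ft i psi -> s \in psi \/ s = seg_to L i.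
  rewrite /mseg_ft -/L; case: eqP => [->|_]; rewrite in_msetD in_mset1.
    by case/orP => [|/eqP]; [left|right].
  case/orP => [|/eqP]; last by right.
  by rewrite in_msetB => /(leq_ltn_trans (leq0n _)); rewrite -in_mset; left.
split=> [s /sub[/mpsi //|->]|k k0]; first by exists (i - L%:R + 1), L.
apply: contrapT => nex.
have all_in j : seg j k \in mseg_ft i psi.
  by apply: contrapT => nj; apply: nex; exists j; apply/negP.
have [j0 j0psi] := apsi _ k0.
have E : seg j0 k = seg_to L i by have [h|//] := sub _ (all_in j0); rewrite h in j0psi.
have kL : k = L by rewrite -(size_seg j0 k) E size_seg.
rewrite {}kL in k0 all_in j0psi E nex.
have mi : psi (seg_to L i) = 0%N by apply/mset_eq0P; rewrite -E.
have mi1 : seg_to L (i - 1) \in psi.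
  have [//|/(seg_inj k0)/addIr/addIr/eqP] := sub _ (all_in (i - 1 - L%:R + 1)).
  by rewrite -subr_eq0 addrAC subrr add0r oppr_eq0 oner_eq0.
have Llen : (L <= max_len psi)%N by rewrite -(size_seg (i - 1 - L%:R + 1) L) le_max_len.
have := @ell0P _ psi i L.+1 Llen.
rewrite -/L /Sval big_ltn ?ltnS // gerDr mi subr0 lez_nat leqNgt.
by rewrite -in_mset mi1.
Qed.

Definition aperiodic_mseg (e : nat) :=
  {psi : {mset seq 'Z_e} | `[< aperiodic psi >]}.

Definition Binf_ft e (i : 'Z_e) (psi : aperiodic_mseg e) : aperiodic_mseg e :=
  exist _ (mseg_ft i (val psi))
    (asboolT (aperiodic_ft i (asboolW (valP psi)))).

Definition Binf_et e (i : 'Z_e) (psi : aperiodic_mseg e) :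
    option (aperiodic_mseg e) :=
  if pselect (exists psi', Binf_ft i psi' = psi) is left ex
  then Some (sval (cid ex)) else None.

Definition Binf_eps e (i : 'Z_e) (psi : aperiodic_mseg e) : int :=
  (max_iter (Binf_et i) psi)%:Z.

Definition Binf (e : nat) : crystal e :=
  @Crystal e (aperiodic_mseg e)
    (fun psi => mseg_wt (val psi))
    (fun i psi => (Binf_eps i psi)%:E)
    (fun i psi => (Binf_eps i psi + pairing (mseg_wt (val psi)) i)%:E)
    (@Binf_et e)
    (fun i psi => Some (Binf_ft i psi)).

Definition fv e l (v : l.-tuple int) (la : mpart l) : {mset seq 'Z_e} :=
  seq_mset (flatten
    [seq [seq seg ((1 - j%:Z + v`_c)%:~R : 'Z_e) (part la c j)
         | j <- iota 1 (size (mcomp la c))]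
    | c <- iota 0 l]).

Lemma fv_aperiodic e l (v : l.-tuple int) (la : mpart l) :
  flotw e v la -> aperiodic (fv e v la).
Proof.
move=> [_ _ fl].
have inP s : s \in fv e v la -> exists c j,
    [/\ (c < l)%N, (0 < j)%N, (0 < part la c j)%N
      & s = seg ((1 - j%:Z + v`_c)%:~R : 'Z_e) (part la c j)].
  rewrite (perm_mem (perm_eq_seq_mset _)) => /flatten_mapP[c].
  rewrite mem_iota add0n => /andP[_ cl] /mapP[[|j]]; rewrite mem_iota //= add1n ltnS.
  move=> jl ->; exists c, j.+1; split=> //=.
  have clt : (c < size (val la))%N by rewrite size_tuple.
  have /andP[_ n0] : is_part (mcomp la c).
    by have /allP := valP la; apply; rewrite mem_nth.
  by rewrite lt0n; apply: contraNneq n0 => <-; rewrite mem_nth.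
split=> [s /inP[c [j [_ _ p0 ->]]]|k k0].
  by eexists; eexists; split; [exact: p0|].
apply: contrapT => nex; apply: (fl _ k0) => r.
have /inP[c [j [cl j0 p0 E]]] : seg (r - k%:R + 1) k \in fv e v la.
  by apply: contrapT => nj; apply: nex; exists (r - k%:R + 1); apply/negP.
have kE : part la c j = k by rewrite -(size_seg (r - k%:R + 1) k) E size_seg.
exists j%:Z, c; split=> //.
rewrite kE in E; have := seg_inj k0 E => {}E.
have -> : r = (r - k%:R + 1) + (k%:Z - 1)%:~R.
  by rewrite rmorphB addrACA subrr addr0 subrK.
by rewrite E -intrD; congr _%:~R; rewrite -[1 - _]opprB; ring.
Qed.

Definition Phi_emb e l (v : l.-tuple int)
    (la : Phi e v) : tensor (Binf e) (T_crystal (Lambda e v)) :=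
  (exist _ (fv e v (val la)) (asboolT (fv_aperiodic (asboolW (valP la)))), tt).

(* Main.v *)
(** Write L c s for the length of the row of component c whose first node has
    content s.  The FLOTW inequalities say that L is monotone along the
    periodic order in which (c, s) dominates (c', s') when s' <= s and c <=
    c', or s' <= s - e.  On the addable and removable i-nodes this makes the
    order [prec] refine the order by column with A before R in each column,
    which is the order on segments underlying the sums S_(k,i): indeed S_(k,i)
    is the number of A minus the number of R to the right of a threshold, as
    equal consecutive rows contribute cancelling terms.  Deleting RA pairs
    then identifies the leftmost remaining R (the rightmost remaining A) with
    the largest (smallest) k minimizing S_(k,i), the minimum being minus the
    number of remaining R.  The operators preserve the FLOTW conditions: if
    removing the leftmost remaining R broke them, another R of the same column
    would precede it in the word with no A in between, and so would remain
    too; likewise for A.  Injectivity holds since the rows with a given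
    residue of s form a chain.  Uniqueness goes by descending to the empty
    multisegment, which is determined by its weight; here the delta component
    makes the simple roots linearly independent. *)

From HB Require Import structures.
From mathcomp Require Import all_boot all_order all_algebra.
From mathcomp Require Import finmap multiset ring zify.
From mathcomp Require Import boolp classical_sets constructive_ereal.
Require Import Defs.
From mathcomp Require Import all_boot all_order all_algebra.
Set Implicit Arguments.
Unset Strict Implicit.
Unset Printing Implicit Defensive.
Import Order.TTheory GRing.Theory Num.Theory.
Local Open Scope mset_scope.
Local Open Scope ring_scope.

(** * Words in removable and addable letters *)

Section Words.
Variables (T : eqType) (R A : pred T).
Implicit Types (p : pred T) (w u v : seq T).

Definition height p w : int := \sum_(x <- w | p x) ((A x : nat)%:Z - (R x : nat)%:Z).

Lemma height_cat p u v : height p (u ++ v) = height p u + height p v.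
Proof. exact: big_cat. Qed.

Lemma height_cons p x w :
  height p (x :: w) = (p x)%:Z * ((A x : nat)%:Z - (R x : nat)%:Z) + height p w.
Proof.
by rewrite /height big_cons; case: ifP => _; rewrite ?mul1r // mul0r add0r.
Qed.

Lemma delete_RA_cases w :
  delete_RA R A w = w /\ sorted (fun x y => ~~ (R x && A y)) w \/
  exists u r a v,
    [/\ w = u ++ [:: r, a & v], delete_RA R A w = u ++ v, R r & A a].
Proof.
elim: w => [|x [|y w] IH]; first by left.
  by left.
rewrite [delete_RA _ _ _]/=; case: ifP => [/andP[Rx Ay]|/negbT nRA].
  by right; exists [::], x, y, w.
case: IH => [[IH1 IH2]|[u [r [a [v [E D Rr Aa]]]]]]; [left|right].
  by split; [congr cons|rewrite /= nRA].
by exists (x :: u), r, a, v; split; rewrite ?cat_cons //; congr cons.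
Qed.

(** Facts about the reduced word are obtained as invariants of a single deletion, so the order in
    which pairs are deleted never matters. *)
Lemma reduce_RA_ind (P : seq T -> Prop) w :
  P w -> (forall u r a v, R r -> A a -> P (u ++ [:: r, a & v]) -> P (u ++ v)) ->
  P (reduce_RA R A w).
Proof.
move=> Pw Pdel; rewrite /reduce_RA; elim: (size w) => //= n IH.
have [[-> _] //|[u [r [a [v [E -> Rr Aa]]]]]] := delete_RA_cases (iter n (delete_RA R A) w).
by apply: (Pdel _ r a) => //; rewrite -E.
Qed.

(** A pass that deletes nothing certifies that no adjacent RA is left, and repeating it changes
    nothing. Every other pass shortens the word, so [size w] passes suffice. *)
Lemma reduce_RA_sorted w : sorted (fun x y => ~~ (R x && A y)) (reduce_RA R A w).
Proof.
suff Hn n u : (size u <= n)%N ->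
    sorted (fun x y => ~~ (R x && A y)) (iter n (delete_RA R A) u) by exact: Hn.
elim: n u => [|n IH] u; first by rewrite leqn0 => /nilP ->.
rewrite iterSr => su.
have [[D Su]|[u1 [r [a [u2 [E D _ _]]]]]] := delete_RA_cases u; last first.
  apply: IH; rewrite -ltnS; apply: leq_trans su.
  by rewrite D E !size_cat /= !addnS ltnS leqnSn.
rewrite D; have -> // : iter n (delete_RA R A) u = u.
by elim: n {IH su} => //= n ->.
Qed.

Lemma reduce_RA_subseq w : subseq (reduce_RA R A w) w.
Proof.
apply: (@reduce_RA_ind (fun w1 => subseq w1 w)) => // u r a v _ _.
apply: subseq_trans; rewrite subseq_cat2l.
exact: (subseq_trans (subseq_cons v a) (subseq_cons _ r)).
Qed.

(** * Reduction of a word sorted compatibly with a level function *)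

Section Word.
(** [lev] abstracts twice the column, plus one for a removable letter. The condition [2 k < lev x]
    then selects the addable letters in columns above [k] and the removable ones in columns at least
    [k]. *)
Variables (prec : rel T) (lev : T -> nat) (w : seq T).
Hypotheses (prec_trans : transitive prec) (prec_irr : irreflexive prec).
Hypothesis w_sorted : pairwise prec w.
Hypothesis lev_prec : {in w &, forall x y, (lev x < lev y)%N -> prec x y}.
Hypothesis R_odd : {in w, forall x, R x = odd (lev x)}.
Hypothesis A_even : {in w, forall x, A x = ~~ odd (lev x)}.

Let w' := reduce_RA R A w.
Let S (k : nat) := height (fun x => k.*2 < lev x)%N w.

Let prec_asym x y : prec x y -> prec y x -> False.
Proof. by move=> xy /(prec_trans xy); rewrite prec_irr. Qed.

Let A_notR x : x \in w -> A x = ~~ R x.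
Proof. by move=> xw; rewrite A_even // R_odd. Qed.

Let sub_w x : x \in w' -> x \in w.
Proof. exact/mem_subseq/reduce_RA_subseq. Qed.

Lemma lev_sorted x y : x \in w -> y \in w -> prec x y -> (lev x <= lev y)%N.
Proof.
move=> xw yw xy; rewrite leqNgt; apply/negP => /(lev_prec yw xw).
exact: prec_asym.
Qed.

(** For an up-closed [p], deleting [r] and [a] changes [height p] only if [r] is outside [p] and [a]
    inside. The condition then places [g] neither before [r] nor after [a], so the two are not
    adjacent as long as [g] survives. *)
Definition separates p g :=
  {in w &, forall r a, R r -> A a -> ~~ p r -> p a -> ~~ prec g r && ~~ prec a g}.

Let up_closed p := {in w &, forall x y, prec x y -> p x -> p y}.

Let height_pair p r a : r \in w -> a \in w -> R r -> A a ->
  height p [:: r; a] = (p a)%:Z - (p r)%:Z.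
Proof.
move=> rw aw Rr Aa; rewrite !height_cons /height big_nil addr0.
have -> : R a = false by move: Aa; rewrite A_notR // => /negbTE.
by rewrite Rr Aa A_notR // Rr subr0 mulr1 sub0r mulrN1 addrC.
Qed.

Let step u r a v : subseq (u ++ [:: r, a & v]) w ->
  [/\ r \in w, a \in w, prec r a, {in u, forall x, prec x r /\ prec x a}
    & {in v, forall x, prec r x /\ prec a x}].
Proof.
move=> sub; have := subseq_pairwise sub w_sorted.
rewrite pairwise_cat /= => /and3P[ruav _ /and3P[/andP[ra rv] av _]].
have mem x : x \in [:: r; a] -> x \in w.
  move=> xra; apply: (mem_subseq sub); rewrite mem_cat; apply/orP; right.
  by move: xra; rewrite !inE orbA => ->.
split; rewrite ?mem ?inE ?eqxx ?orbT //.
  move=> x xu; have /allrelP H := ruav.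
  by split; apply: H; rewrite // !inE eqxx ?orbT.
by move=> x xv; split; [exact: (allP rv)|exact: (allP av)].
Qed.

Let drop_pair u r a v : subseq (u ++ [:: r, a & v]) w -> subseq (u ++ v) w.
Proof.
apply: subseq_trans; rewrite subseq_cat2l.
exact: subseq_trans (subseq_cons v a) (subseq_cons _ r).
Qed.

(** In a deleted pair [r] precedes [a], so [p r] implies [p a]: each deletion lowers the height by
    [p a - p r], which is nonnegative. *)
Lemma height_reduce_le p : up_closed p -> height p w' <= height p w.
Proof.
move=> pup; suff [//] : height p w' <= height p w /\ subseq w' w.
apply: (@reduce_RA_ind (fun w1 => height p w1 <= height p w /\ subseq w1 w)) =>
  [|u r a v Rr Aa [le sub]]; first by split.
have [rw aw ra _ _] := step sub.
split; last exact: drop_pair sub.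
apply: le_trans le; rewrite -cat1s -(cat1s a) catA !height_cat -addrA lerD2l.
rewrite addrA lerDr -height_cat height_pair // subr_ge0 lez_nat.
by case pr: (p r) => //; rewrite (pup _ _ rw aw ra pr).
Qed.

Lemma height_reduce p g : up_closed p -> separates p g -> g \in w' ->
  height p w' = height p w.
Proof.
move=> pup psep.
suff [] : (g \in w' -> height p w' = height p w) /\ subseq w' w by [].
apply: (@reduce_RA_ind (fun w1 => (g \in w1 -> height p w1 = height p w) /\ subseq w1 w)) =>
  [|u r a v Rr Aa [IH sub]]; first by split.
have [rw aw ra ur vr] := step sub.
split; last exact: drop_pair sub.
rewrite mem_cat => guv; rewrite -IH; last first.
  by rewrite mem_cat !inE; case/orP: guv => ->; rewrite ?orbT.
rewrite -[in RHS]cat1s -[in RHS](cat1s a) catA !height_cat -addrA; congr (_ + _).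
rewrite addrA -height_cat height_pair //.
suff -> : p a = p r by rewrite subrr add0r.
case pr: (p r); first by rewrite (pup _ _ rw aw ra pr).
apply/negbTE/negP => pa.
have /andP[/negP gr /negP ag] := psep _ _ rw aw Rr Aa (negbT pr) pa.
by case/orP: guv => [/ur[]|/vr[]].
Qed.

Lemma height_reduceT : height predT w' = height predT w.
Proof.
suff [] : height predT w' = height predT w /\ subseq w' w by [].
apply: (@reduce_RA_ind (fun w1 => height predT w1 = height predT w /\ subseq w1 w)) =>
  [|u r a v Rr Aa [<- sub]]; first by split.
have [rw aw ra ur vr] := step sub.
split; last exact: drop_pair sub.
rewrite -[in RHS]cat1s -[in RHS](cat1s a) catA !height_cat -addrA; congr (_ + _).
by rewrite addrA -height_cat height_pair // subrr add0r.
Qed.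

Lemma heightE p : height p w' = (count (predI p A) w')%:Z - (count (predI p R) w')%:Z.
Proof.
elim: (w') => [|x u IH]; first by rewrite /height big_nil.
rewrite height_cons IH /=.
by case: (p x) (A x) (R x) => -[] [] /=; lia.
Qed.

Lemma count_reduce :
  (count A w')%:Z - (count R w')%:Z = height predT w.
Proof. by rewrite -height_reduceT heightE. Qed.

Let up_lev k : up_closed (fun x => k < lev x)%N.
Proof. by move=> x y xw yw /(lev_sorted xw yw) xy /leq_trans; apply. Qed.

(** Reduction does not increase the height above a threshold, and in the reduced word that height is
    at least minus the number of all remaining R. *)
Lemma unmatched_le k : - (count R w')%:Z <= S k.
Proof.
rewrite /S; apply: le_trans _ (height_reduce_le (@up_lev k.*2)).
rewrite heightE -[leLHS]add0r lerB // lez_nat; apply: sub_count => x /andP[]//.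
Qed.

(** Each letter is either A or R, so a word without adjacent RA has the shape A...AR...R. *)
Let RA_pairwise : pairwise (fun x y => R x ==> R y) w'.
Proof.
rewrite -sorted_pairwise; last by move=> y x z; case: (R x) (R y) (R z) => -[] [].
apply: (@sub_in_sorted _ (mem w) (fun x y => ~~ (R x && A y))) (reduce_RA_sorted w).
  by move=> x y _ yw; rewrite A_notR // negb_and negbK implybE.
exact/allP/sub_w.
Qed.

Lemma first_removable g : ohead [seq x <- w' | R x] = Some g ->
  exists u v, [/\ w' = u ++ g :: v, {in u, forall x, ~~ R x},
    R g & {in v, forall x, R x}].
Proof.
move: RA_pairwise; elim: (w') => //= x t IH /andP[xt tt].
case: ifP => [Rx [<-]|nR /(IH tt)[u [v [-> uR Rg vR]]]].
  exists [::], t; split=> // y yt.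
  by have := allP xt y yt; rewrite Rx.
exists (x :: u), v; split=> // y; rewrite inE => /predU1P[->|/uR//].
by rewrite nR.
Qed.

Lemma last_addable g : ohead (rev [seq x <- w' | A x]) = Some g ->
  exists u v, [/\ w' = u ++ g :: v, {in u, forall x, A x},
    A g & {in v, forall x, ~~ A x}].
Proof.
have : all (mem w) w' by exact/allP/sub_w.
move: RA_pairwise; elim/last_ind: (w') => //= t x IH.
rewrite -cats1 pairwise_cat all_cat filter_cat rev_cat /= => /and3P[tx pt _].
move=> /and3P[tw xw _]; have tx' := allrelP tx.
case: ifP => [Ax [<-]|nA /(IH pt tw)[u [v [-> uA Ag vA]]]].
  exists t, [::]; split=> [|y yt||y]; rewrite ?in_nil ?cats1 //.
  have yw : y \in w := allP tw y yt.
  have := tx' y x yt (mem_head _ _); rewrite implybE (A_notR yw).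
  by move: Ax; rewrite A_notR // => /negbTE->; rewrite orbF.
exists u, (rcons v x); rewrite -cats1 -catA; split=> // y.
by rewrite mem_cat inE => /orP[/vA//|/eqP->]; rewrite nA.
Qed.

Let count_split p u g v : w' = u ++ g :: v ->
  count p w' = (count p u + (p g + count p v))%N.
Proof. by move=> ->; rewrite count_cat. Qed.

Let count_none p u : {in u, forall x, ~~ p x} -> count p u = 0%N.
Proof.
by move=> H; apply/eqP; rewrite -leqn0 leqNgt -has_count; apply/hasPn.
Qed.

Let mem_split u g v x : w' = u ++ g :: v -> x \in u \/ x = g \/ x \in v -> x \in w.
Proof.
move=> E H; apply: sub_w; rewrite E mem_cat inE.
by case: H => [->|[->|->]]; rewrite ?eqxx ?orbT.
Qed.

Let split_prec u g v : w' = u ++ g :: v ->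
  {in u, forall x, prec x g} /\ {in v, forall x, prec g x}.
Proof.
move=> E; have := subseq_pairwise (reduce_RA_subseq w) w_sorted.
rewrite -/w' E pairwise_cat /= => /and3P[ug _ /andP[gv _]].
by split=> x xu; [apply: (allrelP ug); rewrite ?mem_head|exact: (allP gv)].
Qed.

(** In A...AR...R the threshold [2 b] keeps all the R and none of the A, while a threshold beyond
    column [b] loses [g]. With [unmatched_le], [b] is the largest minimizer of [S]. *)
Lemma first_removableP g b : ohead [seq x <- w' | R x] = Some g ->
    lev g = b.*2.+1 ->
  [/\ (0 < count R w')%N, S b = - (count R w')%:Z
    & forall k, (b < k)%N -> - (count R w')%:Z < S k].
Proof.
move=> /first_removable[u [v [E uR Rg vR]]] levg.
have [ug gv] := split_prec E.
have gw' : g \in w' by rewrite E mem_cat mem_head orbT.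
have gw := sub_w gw'.
have uA x : x \in u -> A x by move=> xu; rewrite A_notR ?uR ?(mem_split E) //; left.
have vA x : x \in v -> ~~ A x.
  by move=> xv; rewrite A_notR ?(mem_split E) ?vR //; right; right.
have cR : count R w' = (count R v).+1.
  by rewrite (count_split _ E) count_none // Rg add0n.
split; first by rewrite cR.
  rewrite /S -(height_reduce (g := g)) //; last first.
    (* An addable letter above the threshold and before [g] would have the odd level of [g]. *)
    move=> r a rw aw Rr Aa; rewrite -leqNgt => lr la; apply/andP; split.
      by apply/negP => /(lev_sorted gw rw); rewrite levg leqNgt ltnS lr.
    apply/negP => /(lev_sorted aw gw); rewrite levg => la'.
    have /eqP ela : lev a == b.*2.+1 by rewrite eqn_leq la' la.
    by move: Aa; rewrite A_even // ela /= odd_double.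
  rewrite heightE.
  have -> : count (predI (fun x => b.*2 < lev x)%N A) w' = 0%N.
    apply: count_none => x; rewrite E mem_cat inE => /or3P[xu|/eqP->|/vA]/=.
    - have xw : x \in w by apply: (mem_split E); left.
      apply/andP => -[/= lx]; rewrite A_even //.
      have := lev_sorted xw gw (ug _ xu); rewrite levg => lx' olx.
      have /eqP elx : lev x == b.*2.+1 by rewrite eqn_leq lx' lx.
      by move: olx; rewrite elx /= odd_double.
    - by rewrite A_notR // Rg andbF.
    - by move=> /negbTE->; rewrite andbF.
  rewrite sub0r; congr (- (_%:Z)); apply: eq_in_count => x.
  rewrite E mem_cat inE /= => /or3P[/uR/negbTE->|/eqP->|xv]; rewrite ?andbF //.
    by rewrite levg leqnn.
  rewrite vR // andbT (leq_trans _ (lev_sorted gw _ (gv _ xv))) ?levg //.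
  by apply: (mem_split E); right; right.
move=> k bk; rewrite /S; apply: lt_le_trans _ (height_reduce_le (@up_lev k.*2)).
rewrite heightE.
suff: (count (predI (fun x => k.*2 < lev x)%N R) w' < count R w')%N by lia.
rewrite cR ltnS.
rewrite (count_split _ E) /= (count_none (u := u)); last first.
  by move=> x /uR /negbTE /= ->; rewrite andbF.
have -> : (k.*2 < lev g)%N = false by lia.
rewrite !add0n.
by apply: sub_count => x /andP[].
Qed.

(** The threshold [2 b] again keeps exactly the remaining R, while a threshold below column [b] also
    keeps [g]. With [unmatched_le], [b] is the smallest minimizer of [S]. *)
Lemma last_addableP g b : ohead (rev [seq x <- w' | A x]) = Some g ->
    lev g = b.*2 ->
  [/\ (0 < count A w')%N, S b = - (count R w')%:Z
    & forall k, (k < b)%N -> - (count R w')%:Z < S k].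
Proof.
move=> /last_addable[u [v [E uA Ag vA]]] levg.
have [ug gv] := split_prec E.
have gw' : g \in w' by rewrite E mem_cat mem_head orbT.
have gw := sub_w gw'.
have uR x : x \in u -> ~~ R x.
  by move=> xu; rewrite -A_notR ?uA ?(mem_split E) //; left.
have vR x : x \in v -> R x.
  move=> xv; have := vA x xv.
  by rewrite A_notR ?negbK ?(mem_split E) //; right; right.
have gR : ~~ R g by rewrite -A_notR.
have cR : count R w' = count R v.
  by rewrite (count_split _ E) count_none // (negbTE gR) !add0n.
split; first by rewrite (count_split _ E) Ag addnCA add1n.
  rewrite /S -(height_reduce (g := g)) //; last first.
    move=> r a rw aw Rr Aa; rewrite -leqNgt => lr la; apply/andP; split.
      apply/negP => /(lev_sorted gw rw); rewrite levg => lr'.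
      have /eqP elr : lev r == b.*2 by rewrite eqn_leq lr' lr.
      by move: Rr; rewrite R_odd // elr odd_double.
    by apply/negP => /(lev_sorted aw gw); rewrite levg leqNgt la.
  rewrite heightE.
  have -> : count (predI (fun x => b.*2 < lev x)%N A) w' = 0%N.
    apply: count_none => x; rewrite E mem_cat inE => /or3P[xu|/eqP->|/vA]/=.
    - have xw : x \in w by apply: (mem_split E); left.
      by rewrite -levg ltnNge (lev_sorted xw gw (ug _ xu)).
    - by rewrite levg ltnn.
    - by move=> /negbTE->; rewrite andbF.
  rewrite sub0r; congr (- (_%:Z)); apply: eq_in_count => x.
  rewrite E mem_cat inE /= => /or3P[/uR/negbTE->|/eqP->|xv]; rewrite ?andbF //.
    by rewrite (negbTE gR) andbF.
  have xw : x \in w by apply: (mem_split E); right; right.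
  rewrite vR // andbT ltn_neqAle -{2}levg (lev_sorted gw xw (gv _ xv)) andbT.
  by apply/eqP => ex; have := vR _ xv; rewrite R_odd // -ex odd_double.
move=> k kb; rewrite /S; apply: lt_le_trans _ (height_reduce_le (@up_lev k.*2)).
rewrite heightE cR.
have -> : count (predI (fun x => k.*2 < lev x)%N R) w' = count R v.
  rewrite -cR; apply: eq_in_count => x.
  rewrite E mem_cat inE /= => /or3P[/uR/negbTE->|/eqP->|xv]; rewrite ?andbF //.
    by rewrite (negbTE gR) andbF.
  have xw : x \in w by apply: (mem_split E); right; right.
  rewrite vR // andbT (leq_trans _ (lev_sorted gw xw (gv _ xv))) //.
  by rewrite levg ltn_double.
rewrite ltrDr ltz_nat (count_split _ E) /= Ag levg ltn_double kb /=.
by rewrite addnCA add1n.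
Qed.

(** An addable letter deleted together with [g'] would lie between [g'] and the surviving [g], hence
    have their common odd level. So [g'] survives too, against the choice of [g] as first. *)
Lemma no_removable_twin g g' : ohead [seq x <- w' | R x] = Some g ->
  g' \in w -> R g' -> prec g' g -> lev g' = lev g -> False.
Proof.
move=> /first_removable[u [v [E uR Rg vR]]] g'w Rg' g'g levE.
have [ug gv] := split_prec E.
have gw' : g \in w' by rewrite E mem_cat mem_head orbT.
have gw := sub_w gw'.
have : g' \in w'.
  suff [] : (g \in w' -> g' \in w') /\ subseq w' w by move/(_ gw').
  apply: (@reduce_RA_ind (fun w1 => (g \in w1 -> g' \in w1) /\ subseq w1 w)) =>
    [|x r a y Rr Aa [IH sub]]; first by split.
  have [rw aw ra ur vr] := step sub.
  split; last exact: drop_pair sub.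
  rewrite !mem_cat => gxy.
  have : g' \in x ++ [:: r, a & y].
    by apply: IH; rewrite mem_cat !inE; case/orP: gxy => ->; rewrite ?orbT.
  rewrite mem_cat !inE => /or4P[-> //| /eqP g'r | /eqP g'a | ->]; last 1 first.
  - by rewrite orbT.
  - case/orP: gxy => [/ur[gr _]|/vr[_ ag]].
      by case: (prec_asym g'g); rewrite g'r.
    have := lev_sorted aw gw ag; have := lev_sorted rw aw ra.
    rewrite -g'r levE => le1 le2; have /eqP ela : lev a == lev g by rewrite eqn_leq le1 le2.
    by move: Aa; rewrite A_even // ela -R_odd // Rg.
  - by move: Aa; rewrite -g'a A_notR // Rg'.
rewrite E mem_cat inE => /or3P[/uR|/eqP ge|/gv gg'].
- by rewrite Rg'.
- by move: g'g; rewrite ge prec_irr.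
- exact: prec_asym g'g gg'.
Qed.

Lemma no_addable_twin g g' : ohead (rev [seq x <- w' | A x]) = Some g ->
  g' \in w -> A g' -> prec g g' -> lev g' = lev g -> False.
Proof.
move=> /last_addable[u [v [E uA Ag vA]]] g'w Ag' gg' levE.
have [ug gv] := split_prec E.
have gw' : g \in w' by rewrite E mem_cat mem_head orbT.
have gw := sub_w gw'.
have : g' \in w'.
  suff [] : (g \in w' -> g' \in w') /\ subseq w' w by move/(_ gw').
  apply: (@reduce_RA_ind (fun w1 => (g \in w1 -> g' \in w1) /\ subseq w1 w)) =>
    [|x r a y Rr Aa [IH sub]]; first by split.
  have [rw aw ra ur vr] := step sub.
  split; last exact: drop_pair sub.
  rewrite !mem_cat => gxy.
  have : g' \in x ++ [:: r, a & y].
    by apply: IH; rewrite mem_cat !inE; case/orP: gxy => ->; rewrite ?orbT.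
  rewrite mem_cat !inE => /or4P[-> //| /eqP g'r | /eqP g'a | ->]; last 1 first.
  - by rewrite orbT.
  - by move: Ag'; rewrite g'r A_notR // Rr.
  - case/orP: gxy => [/ur[gr _]|/vr[_ ag]]; last first.
      by case: (prec_asym gg'); rewrite g'a.
    have := lev_sorted gw rw gr; have := lev_sorted rw aw ra.
    rewrite -g'a levE => le1 le2; have /eqP elr : lev r == lev g by rewrite eqn_leq le1 le2.
    by move: Rr; rewrite R_odd // elr -[odd _]negbK -A_even // Ag.
rewrite E mem_cat inE => /or3P[/ug g'g|/eqP ge|/vA].
- exact: prec_asym g'g gg'.
- by move: gg'; rewrite ge prec_irr.
- by rewrite Ag'.
Qed.

End Word.
End Words.

(** * Multisegments *)

Section Multisegments.
Variable e : nat.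
Implicit Types (psi : {mset seq 'Z_e}) (i j : 'Z_e) (k r : nat).

Lemma seg_to_inj i j k r : (0 < k)%N -> seg_to k i = seg_to r j -> k = r /\ i = j.
Proof.
move=> k0 E; have kr : k = r by rewrite -(size_seg (i - k%:R + 1) k) -/(seg_to k i) E size_seg.
by split=> //; move: E; rewrite -kr => /(seg_inj k0)/addIr/addIr.
Qed.

(** The ring ['Z_e] is nontrivial for every [e]. *)
Lemma pred_neq i : (i - 1 == i) = false.
Proof. by rewrite -subr_eq0 addrAC subrr add0r oppr_eq0 oner_eq0. Qed.

Lemma mset_long psi s : (max_len psi < size s)%N -> psi s = 0%N.
Proof.
by rewrite ltnNge => ns; apply/mset_eq0P; apply: contra ns; exact: le_max_len.
Qed.

(** This allows the sums of two multisegments to be compared over a common range. *)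
Lemma Sval_wide psi i k N : (max_len psi < N)%N ->
  Sval psi i k =
  \sum_(k <= r < N) ((psi (seg_to r (i - 1)))%:Z - (psi (seg_to r i))%:Z).
Proof.
move=> MN; have zero r : (max_len psi < r)%N ->
    (psi (seg_to r (i - 1)))%:Z - (psi (seg_to r i))%:Z = 0.
  by move=> Mr; rewrite !mset_long ?subrr // size_seg.
have [kM|Mk] := leqP k (max_len psi).+1.
  rewrite [RHS](big_cat_nat (n := (max_len psi).+1)) //=.
  rewrite [X in _ + X]big1_seq ?addr0 // => r /=.
  by rewrite mem_index_iota => /andP[Mr _]; exact: zero.
rewrite /Sval big_geq ?(ltnW Mk) // big_nat big1 // => r /andP[kr _].
by apply: zero; apply: leq_trans kr; apply: ltnW.
Qed.

Lemma Sval_long psi i k : (max_len psi < k)%N -> Sval psi i k = 0.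
Proof. by move=> Mk; rewrite /Sval big_geq. Qed.

Lemma ell0_min psi i k : (0 < k)%N -> Sval psi i (ell0 psi i) <= Sval psi i k.
Proof.
move=> k0; have [kM|Mk] := leqP k (max_len psi).+1; first by rewrite ell0P ?k0.
rewrite [leRHS]Sval_long 1?ltnW // -(@Sval_long psi i (max_len psi).+1) //.
by rewrite ell0P ?leqnn.
Qed.

Lemma ell0_lt psi i k : (0 < k < ell0 psi i)%N ->
  Sval psi i (ell0 psi i) < Sval psi i k.
Proof.
case: k => //= k; rewrite {1}/ell0 ltnS; set ks := iota _ _; set p := fun k => _ => kL.
have kM : (k < (max_len psi).+1)%N.
  by apply: leq_trans kL _; rewrite (leq_trans (find_size _ _)) // size_iota.
have /negbT := before_find 0%N kL; rewrite nth_iota // add1n.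
case/allPn => k'; rewrite mem_iota -ltNge => /andP[k'0 _]; apply: le_lt_trans.
exact: ell0_min.
Qed.

Lemma ell0_eq psi i k : (0 < k)%N ->
    (forall r, (0 < r)%N -> Sval psi i k <= Sval psi i r) ->
    (forall r, (0 < r < k)%N -> Sval psi i k < Sval psi i r) ->
  ell0 psi i = k.
Proof.
move=> k0 kmin klt; apply/eqP; rewrite eqn_leq; apply/andP; split; rewrite leqNgt; apply/negP.
  move=> kL; have := @ell0_lt psi i k; rewrite k0 kL => /(_ isT).
  by rewrite ltNge kmin.
by move=> Lk; have := klt (ell0 psi i); rewrite Lk => /(_ isT); rewrite ltNge ell0_min.
Qed.

(** The closed formula for epsilon: minus the minimum of [S_(k,i)]. On the multisegments [fv e v la]
    it is matched with the number of unmatched R. *)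
Definition mseg_eps psi i : int := - Sval psi i (ell0 psi i).

Lemma mseg_eps_eq psi i k : (0 < k)%N ->
  (forall r, (0 < r)%N -> Sval psi i k <= Sval psi i r) ->
  mseg_eps psi i = - Sval psi i k.
Proof.
by move=> k0 kmin; congr (- _); apply/eqP; rewrite eq_le ell0_min ?kmin.
Qed.

Lemma mseg_eps_ge0 psi i : 0 <= mseg_eps psi i.
Proof.
rewrite oppr_ge0 -(@Sval_long psi i (max_len psi).+1) //; exact: ell0_min.
Qed.

(* [psi' = psi - (k-1;i-1] + (k;i]], written without truncated subtraction;
   there is nothing to remove when [k = 1].                                   *)
Definition grows i k psi psi' := (0 < k)%N /\
  forall x, (psi' x + ((1 < k) && (x == seg_to k.-1 (i - 1)%R)) =
             psi x + (x == seg_to k i))%N.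

Lemma grows_uniq i k psi psi1 psi2 :
  grows i k psi psi1 -> grows i k psi psi2 -> psi1 = psi2.
Proof. by case=> _ E1 [_ E2]; apply/msetP => x; have := E1 x; have := E2 x; lia. Qed.

Lemma grows_inj i k psi psi1 psi2 :
  grows i k psi1 psi -> grows i k psi2 psi -> psi1 = psi2.
Proof. by case=> _ E1 [_ E2]; apply/msetP => x; have := E1 x; have := E2 x; lia. Qed.

Lemma sum_nat_indicator k m n :
  \sum_(m <= r < n) (r == k :> nat)%:Z = (m <= k < n)%N%:Z.
Proof.
transitivity (\sum_(m <= r < n | r == k) 1%:Z : int); last first.
  by rewrite big_nat1_eq; case: (_ && _).
by rewrite [RHS]big_mkcond; apply: eq_bigr => r _; case: eqP.
Qed.

(** The new segment [(k; i]] contributes -1 for [r <= k], and the segment [(k-1; i-1]] that is lost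
    contributed +1 for [r < k]. *)
Lemma grows_Sval i k psi psi' r : grows i k psi psi' -> (0 < r)%N ->
  Sval psi' i r = Sval psi i r - (r <= k)%N%:Z - (r < k)%N%:Z.
Proof.
case=> k0 E r0; pose N := (max_len psi + max_len psi' + k).+1.
rewrite (@Sval_wide psi _ _ N) ?(@Sval_wide psi' _ _ N); try by rewrite /N; lia.
have -> : (r <= k)%N = (r <= k < N)%N by rewrite /N; lia.
have -> : (r < k)%N = (1 < k)%N && (r <= k.-1 < N)%N by rewrite /N; lia.
rewrite -sum_nat_indicator -sumrB.
have -> : ((1 < k)%N && (r <= k.-1 < N)%N)%:Z =
    \sum_(r <= q < N) ((1 < k)%N && (q == k.-1))%:Z.
  case: (1 < k)%N; first by rewrite -sum_nat_indicator.
  by rewrite big1.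
rewrite -sumrB big_nat [RHS]big_nat; apply: eq_bigr => q /andP[rq _].
have q0 : (0 < q)%N := leq_trans r0 rq.
have eqE j p j' : (0 < p)%N -> (seg_to q j == seg_to p j') = (q == p) && (j == j').
  move=> p0; apply/eqP/andP => [/(seg_to_inj q0)[-> ->]|[/eqP-> /eqP->]//].
  by rewrite !eqxx.
have := E (seg_to q (i - 1)); have := E (seg_to q i).
rewrite !(eqE _ k) // eqxx pred_neq !(andbT, andbF).
have [k1|k1] := boolP (1 < k)%N.
  by rewrite !eqE -1?ltnS ?prednK // eqxx (eq_sym i) pred_neq !andbT andbF /=; lia.
by rewrite /=; lia.
Qed.

Lemma grows_ft i psi : grows i (ell0 psi i) psi (mseg_ft i psi).
Proof.
split=> // x; rewrite /mseg_ft; set k := ell0 psi i; case: eqP => [->|k1].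
  by rewrite msetE2 msetnE addn0; case: eqP.
have kgt1 : (1 < k)%N by rewrite ltn_neqAle eq_sym; apply/andP; split=> //; apply/eqP.
rewrite kgt1 !msetE2 !msetnE /=.
(* The segment to be replaced does occur: [S_(k-1,i) > S_(k,i)] by the choice of the smallest
   minimizer, and the difference is the multiplicity of [(k-1; i-1]] minus that of [(k-1; i]]. *)
suff : (0 < psi (seg_to k.-1 (i - 1)%R))%N.
  move: (seg_to k.-1 (i - 1)) => t; have [->|_] := eqVneq x t.
    by case: eqP => _; move: (psi t) => [|n] //; rewrite subn1 /=; lia.
  by case: eqP => _ _; rewrite subn0 !addn0.
have k10 : (0 < k.-1)%N by lia.
have : (0 < k.-1 < ell0 psi i)%N by rewrite k10 -/k; lia.
move/ell0_lt; rewrite -/k /Sval.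
have [kM|Mk] := leqP k (max_len psi).+1; last first.
  by rewrite !big_geq //; lia.
rewrite [ltRHS]big_ltn ?prednK //; try lia.
by rewrite ltrDr subr_gt0 ltz_nat; apply: leq_trans.
Qed.

(** The smallest minimizer of [S] governs [mseg_ft]; the largest one governs its inverse. *)
Definition last_min psi i k :=
  [/\ (0 < k)%N, forall r, (0 < r)%N -> Sval psi i k <= Sval psi i r
    & forall r, (k < r)%N -> Sval psi i k < Sval psi i r].

Lemma last_min_uniq psi i k1 k2 : last_min psi i k1 -> last_min psi i k2 -> k1 = k2.
Proof.
move=> [k10 m1 l1] [k20 m2 l2]; case: (ltngtP k1 k2) => // [/l1|/l2].
  by rewrite ltNge m2.
by rewrite ltNge m1.
Qed.

(** Applying [mseg_ft] lowers [S_r] by 2 before [ell0], by 1 at it and by 0 after it. Values before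
    [ell0] exceeded the minimum by at least 1, so they may now tie with it, while later values are
    strictly larger. *)
Lemma last_min_ft psi i : last_min (mseg_ft i psi) i (ell0 psi i).
Proof.
have S r := @grows_Sval _ _ _ _ r (grows_ft i psi).
have lt r := @ell0_lt psi i r; have min r := @ell0_min psi i r.
split=> // r r0; last first.
  have r1 : (0 < r)%N by lia.
  by have := min r r1; rewrite !S // leqnn ltnn; lia.
rewrite !S // leqnn ltnn subr0.
case: (ltngtP r (ell0 psi i)) => [rL|Lr|->] /=; last by rewrite subr0.
  by have := lt r; rewrite r0 rL => /(_ isT); lia.
by have := min r r0; lia.
Qed.

Lemma mseg_ft_inj i : injective (@mseg_ft e i).
Proof.
move=> psi1 psi2 E; have g1 := grows_ft i psi1; have g2 := grows_ft i psi2.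
have L12 : ell0 psi1 i = ell0 psi2 i.
  by apply: (last_min_uniq (last_min_ft psi1 i)); rewrite E; exact: last_min_ft.
by move: g1; rewrite L12 E => /grows_inj; apply.
Qed.

Lemma mseg_eps_ft i psi : mseg_eps (mseg_ft i psi) i = mseg_eps psi i + 1.
Proof.
have [L0 Lmin _] := last_min_ft psi i.
rewrite (mseg_eps_eq L0 Lmin) (grows_Sval (grows_ft i psi)) // leqnn ltnn.
by rewrite /mseg_eps; lia.
Qed.

(** Undoing the shift of [S] by 2, 1 and 0 turns the largest minimizer for [psi'] into the smallest
    one for [psi]. *)
Lemma grows_last_min i k psi psi' : grows i k psi psi' -> last_min psi' i k ->
  mseg_ft i psi = psi'.
Proof.
move=> g [k0 kmin klt].
have S r := @grows_Sval _ _ _ _ r g.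
have Lk : ell0 psi i = k.
  apply: ell0_eq => // r.
    move=> r0; have := kmin r r0; have := klt r; rewrite !S // leqnn ltnn.
    by case: (ltngtP r k) => [rk|kr|->] /= H1 H2; rewrite ?lexx //; lia.
  by case/andP => r0 rk; have := kmin r r0; rewrite !S // leqnn ltnn rk (ltnW rk); lia.
by apply: grows_uniq g; rewrite -Lk; exact: grows_ft.
Qed.

(** Only [(k-1; i-1]] can be new in [psi], so a failure happens in length [p = k-1]. Then [psi']
    lacks [(p; i-1]] but contains [(p; i]], whence [S_(p,i) < S_(k,i)], against minimality. *)
Lemma aperiodic_shrink i k psi psi' : aperiodic psi' -> grows i k psi psi' ->
  last_min psi' i k -> aperiodic psi.
Proof.
move=> [mpsi' apsi'] [k0 E] [_ kmin _].
have sub s : s \in psi -> s \in psi' \/ (1 < k)%N /\ s = seg_to k.-1 (i - 1).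
  rewrite !in_mset => s0; have := E s; have [k1|_] /= := boolP (1 < k)%N.
    by case: eqP => [->|_ H]; [right|left; move: H s0; case: (psi s); case: (psi' s); case: eqP].
  by move=> H; left; move: H s0; case: (psi s); case: (psi' s); case: eqP.
split=> [s /sub[/mpsi' //|[k1 ->]]|p p0].
  by exists (i - 1 - k.-1%:R + 1), k.-1; split=> //; rewrite -ltnS prednK.
apply: contrapT => nex.
have all_in j : seg j p \in psi.
  by apply: contrapT => nj; apply: nex; exists j; apply/negP.
have [j0 j0psi] := apsi' _ p0.
have [h|[k1 Ej0]] := sub _ (all_in j0); first by rewrite h in j0psi.
have pk : p = k.-1 by rewrite -(size_seg j0 p) Ej0 size_seg.
have kp : k = p.+1 by rewrite pk prednK.
have mi1 : psi' (seg_to p (i - 1)) = 0%N by apply/mset_eq0P; rewrite pk -Ej0.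
have pos : (0 < psi' (seg_to p i))%N.
  have /sub[|[_]] := all_in (i - p%:R + 1); first by rewrite in_mset.
  rewrite -pk => /(seg_to_inj p0)[_ /esym/eqP].
  by rewrite pred_neq.
have := kmin p p0; rewrite kp /Sval.
have [pM|Mp] := leqP p (max_len psi').
  by rewrite [leRHS]big_ltn // mi1 lerDr sub0r oppr_ge0 lez_nat leqNgt pos.
by move: pos; rewrite mset_long // size_seg.
Qed.

(** Among the segments of maximal length [k], aperiodicity yields one that occurs while its shift by
    -1 does not. If it ends in [i], then [S_(k,i)] is negative. *)
Lemma mseg_eps_gt0 psi : aperiodic psi -> psi != mset0 -> exists i, 0 < mseg_eps psi i.
Proof.
move=> [mpsi apsi] psi0.
have [s0 s0psi] : exists s, s \in psi.
  apply: contrapT => nex; case/eqP: psi0; apply/msetP => x; rewrite mset0E.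
  by apply/mset_eq0P/negP => xpsi; apply: nex; exists x.
set k := max_len psi.
have [s spsi sk] : exists2 s, s \in psi & size s = k.
  apply: contrapT => nex; have szs s : s \in psi -> (size s < k)%N.
    move=> spsi; rewrite ltn_neqAle le_max_len // andbT.
    by apply/eqP => sk; apply: nex; exists s.
  have : (k <= k.-1)%N.
    by apply/bigmax_leqP_seq => s /szs sk _; rewrite -ltnS prednK //; case: (k) sk.
  by have := szs _ s0psi; case: (k) => // k'; rewrite ltnn.
have [j [k' [k'0 sE]]] := mpsi _ spsi.
have k'k : k' = k by rewrite -sk sE size_seg.
rewrite {k'}k'k in k'0 sE.
have [j1 j1psi] := apsi _ k'0.
have [j2 j2psi j2psi'] : exists2 j2, seg j2 k \in psi & seg (j2 - 1) k \notin psi.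
  apply: contrapT => nex.
  (* Otherwise all shifts of [[j; k)] by negative steps occur, including the missing [[j1; k)]. *)
  have all_in n : seg (j - n%:R) k \in psi.
    elim: n => [|n IH]; first by rewrite subr0 -sE.
    apply: contrapT => /negP nin; apply: nex; exists (j - n%:R) => //.
    by rewrite -addrA -opprD natr1.
  by have := all_in (j - j1 : 'Z_e); rewrite natr_Zp opprB addrC subrK (negbTE j1psi).
exists (j2 + k%:R - 1).
rewrite oppr_gt0; apply: (le_lt_trans (ell0_min _ _ k'0)).
rewrite /Sval big_nat1 /seg_to.
have -> : j2 + k%:R - 1 - 1 - k%:R + 1 = j2 - 1 by ring.
have -> : j2 + k%:R - 1 - k%:R + 1 = j2 by ring.
move: j2psi'; rewrite -mset_eq0 => /eqP->.
by rewrite sub0r oppr_lt0 ltz_nat -in_mset.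
Qed.

(** * Sums of simple roots and the weight of a multisegment *)

Lemma sum_root2 (s : seq 'Z_e) : (\sum_(x <- s) simple_root x).2 = (count_mem 0 s)%:Z.
Proof.
by elim: s => [|x s IH]; rewrite ?big_nil // big_cons /= IH PoszD; case: eqP.
Qed.

Lemma sum_root1 (s : seq 'Z_e) i : (\sum_(x <- s) simple_root x).1 i =
  (count_mem i s)%:Z *+ 2 - (count_mem (i + 1) s)%:Z - (count_mem (i - 1) s)%:Z.
Proof.
elim: s => [|x s IH]; first by rewrite big_nil /= ffunE.
rewrite big_cons /= ffunE IH ffunE !PoszD [i == x]eq_sym.
have -> : (i == x + 1) = (x == i - 1) by rewrite -subr_eq eq_sym.
have -> : (i == x - 1) = (x == i + 1) by rewrite eq_sym subr_eq.
by case: (x == i); case: (x == i + 1); case: (x == i - 1); ring.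
Qed.

(** The delta component shows that the residue 0 does not occur. If [n] does not occur, the
    coefficient at [n] is minus the sum of the counts of its two neighbours, so these do not occur
    either. *)
Lemma sum_root_eq0 (s : seq 'Z_e) : \sum_(x <- s) simple_root x = 0 -> s = [::].
Proof.
move=> s0; have c0 n : count_mem (n%:R : 'Z_e) s = 0%N.
  elim: n => [|n IH]; first by have := sum_root2 s; rewrite s0 /= => -[].
  have := sum_root1 s n%:R; rewrite s0 /= ffunE IH -natr1 mul0rn sub0r.
  by move/eqP; rewrite -opprD eq_sym oppr_eq0 -PoszD eqz_nat addn_eq0 => /andP[/eqP].
case: s {s0} c0 => // x s /(_ (x : nat)); by rewrite natr_Zp /= eqxx.
Qed.

Lemma mseg_wt_eq0 psi : multisegment psi -> mseg_wt psi = 0 -> psi = mset0.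
Proof.
move=> mpsi /eqP; rewrite oppr_eq0 => /eqP E.
have /sum_root_eq0 fl : \sum_(x <- flatten psi) simple_root x = 0.
  by rewrite big_flatten.
apply/msetP => s; rewrite mset0E; apply/mset_eq0P/negP => spsi.
have [j [[|k] [// _ sE]]] := mpsi _ spsi.
suff : j \in flatten psi by rewrite fl.
apply/flattenP; exists s => //; rewrite sE; apply/mapP; exists 0%N => //.
by rewrite addr0.
Qed.

(** Along a segment the simple roots are second differences, and their sum telescopes to the two
    ends. *)
Lemma sum_root_seg j k i : (\sum_(x <- seg j k) simple_root x).1 i =
  (i == j)%:Z - (i == j - 1)%:Z + (i == j + k%:R - 1)%:Z - (i == j + k%:R)%:Z.
Proof.
elim: k => [|k IH]; first by rewrite big_nil ffunE addr0 subrK subrr.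
rewrite /seg mkseqS -/(seg j k) big_rcons /= ffunE IH ffunE.
have -> : k.+1%:R = k%:R + 1 :> 'Z_e by rewrite natr1.
rewrite [j + (_ + 1)]addrA addrK.
ring.
Qed.

End Multisegments.

(** * Rows of multipartitions *)

Section Partitions.
Implicit Types s : seq nat.

Lemma sorted_geqP s :
  reflect (forall j, nth 0%N s j.+1 <= nth 0%N s j)%N (sorted geq s).
Proof.
apply: (iffP (sortedP 0%N)) => H j; last by move=> _; exact: H.
by have [/H//|sj] := ltnP j.+1 (size s); rewrite nth_default.
Qed.

(** The zeros of a weakly decreasing sequence form its tail, where the default value is 0 as
    well. *)
Lemma nth_filter_gt0 s j : sorted geq s ->
  nth 0%N [seq x <- s | (0 < x)%N] j = nth 0%N s j.
Proof.
elim: s j => //= x s IH j xs; case: ifP => [x0|/negbT].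
  by case: j => //= j; apply: IH; exact: path_sorted xs.
rewrite -leqNgt leqn0 => /eqP x0.
have gtr : transitive geq by move=> ? ? ? /= yx zy; exact: leq_trans zy yx.
have s0 y : y \in s -> y = 0%N.
  move: xs; rewrite (path_sortedE gtr) => /andP[/allP xs _] /xs /=.
  by rewrite x0 leqn0 => /eqP.
have -> : [seq x <- s | (0 < x)%N] = [::].
  by apply/eqP; rewrite -(negbK (_ == _)) -has_filter; apply/hasPn => y /s0->.
rewrite nth_nil; case: j => //= j.
have [/(mem_nth 0%N)/s0->//|sj] := ltnP j (size s).
by rewrite nth_default.
Qed.

End Partitions.

Local Arguments part : simpl never.

Section Rows.
Variables (e l : nat) (v : l.-tuple int).
Implicit Types (la : mpart l) (a b c k : nat) (i : 'Z_e).

Lemma is_part_mcomp la c : is_part (mcomp la c).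
Proof.
have [cl|lc] := ltnP c l; last by rewrite /mcomp nth_default // size_tuple.
by apply: (allP (valP la)); rewrite mem_nth ?size_tuple.
Qed.

Lemma part_le la c (j j' : int) : 1 <= j -> j <= j' -> (part la c j' <= part la c j)%N.
Proof.
case: j => [[|j]|j] //; case: j' => [[|j']|j'] //= _; rewrite /part lez_nat ltnS => jj'.
have /andP[/sorted_geqP H _] := is_part_mcomp la c.
rewrite -(subnKC jj'); elim: (j' - j)%N => [|n IH]; first by rewrite addn0.
by rewrite addnS; apply: leq_trans IH.
Qed.

Lemma part_out la c a : (l <= c)%N || (size (mcomp la c) < a)%N -> part la c a = 0%N.
Proof.
case: a => [|a] //= H; rewrite /part nth_default //; case/orP: H => // lc.
by rewrite /mcomp nth_default // size_tuple.
Qed.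

Lemma part_gt0 la c a : (0 < part la c a)%N ->
  [/\ (0 < a)%N, (c < l)%N & (a <= size (mcomp la c))%N].
Proof.
move=> p0; split; first by case: a p0.
  by rewrite ltnNge; apply: contraTN p0 => lc; rewrite part_out ?lc.
by rewrite leqNgt; apply: contraTN p0 => lc; rewrite part_out ?lc ?orbT.
Qed.

Lemma part_in la c a : (0 < a <= size (mcomp la c))%N -> (0 < part la c a)%N.
Proof.
case: a => //= a al; rewrite /part; have /andP[_ n0] := is_part_mcomp la c.
by rewrite lt0n; apply: contraNneq n0 => <-; rewrite mem_nth.
Qed.

Lemma mpart_ext la la' :
  (forall c a, (c < l)%N -> (0 < a)%N -> part la c a = part la' c a) -> la = la'.
Proof.
move=> H; apply/val_inj/eq_from_tnth => c.
rewrite !(tnth_nth [::]) -/(mcomp la c) -/(mcomp la' c).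
have sz : size (mcomp la c) = size (mcomp la' c).
  apply/eqP; rewrite eqn_leq; apply/andP; split; rewrite leqNgt; apply/negP => lt.
    have := part_in (la := la) (c := c) (a := size (mcomp la c)).
    by rewrite leqnn andbT H ?part_out ?ltnn ?lt ?orbT //; [|exact: leq_ltn_trans lt];
       move/(_ (leq_ltn_trans (leq0n _) lt)).
  have := part_in (la := la') (c := c) (a := size (mcomp la' c)).
  by rewrite leqnn andbT -H ?part_out ?ltnn ?lt ?orbT //; [|exact: leq_ltn_trans lt];
     move/(_ (leq_ltn_trans (leq0n _) lt)).
by apply: (@eq_from_nth _ 0%N) => // a _; have := H c a.+1 (ltn_ord c) isT.
Qed.

Lemma addableE la a b c : addable la (a, b, c) =
  [&& (0 < a)%N, (c < l)%N, b == (part la c a).+1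
    & (a == 1%N) || (part la c a < part la c a.-1)%N].
Proof.
rewrite /addable /in_diag; case: a => [|a] //.
have mm : (0 < a)%N -> (part la c a.+1 <= part la c a)%N.
  by move=> a0; apply: part_le; lia.
rewrite [a.+1.-1]/=; move: (part la c a.+1) (part la c a) mm => m p mm.
by case: (c < l)%N; lia.
Qed.

Lemma removableE la a b c : removable la (a, b, c) =
  [&& (0 < a)%N, (0 < b)%N, b == part la c a & (part la c a.+1 < b)%N].
Proof.
rewrite /removable /in_diag.
by move: (part la c a.+1) (part la c a) => m p; lia.
Qed.

Lemma addable_notR la g : addable la g -> removable la g = false.
Proof.
case: g => -[a b] c; rewrite addableE removableE => /and4P[_ _ /eqP-> _].
by apply/negbTE/negP => /and4P[_ _ /eqP]; lia.
Qed.

Lemma mem_box la g : addable la g || removable la g -> g \in box la.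
Proof.
case: g => -[a b] c; rewrite addableE removableE => H.
have [a0 b0 cl] : [/\ (0 < a)%N, (0 < b)%N & (c < l)%N].
  case/orP: H => /and4P[a0 H1 /eqP H2 H3]; first by rewrite a0 H1 H2.
  by rewrite a0 H1; split=> //; case: (part_gt0 (la := la) (c := c) (a := a)); lia.
have le1 : (part la c a <= part la c 1)%N by apply: part_le; lia.
apply/flatten_mapP; exists c; first by rewrite mem_iota.
apply/allpairsP; exists (a, b); split; rewrite ?mem_iota //.
  rewrite a0 add1n ltnS /=; case/orP: H => /and4P[_ _ /eqP E H].
    case/orP: H => [/eqP->//|lt].
    have [_ _ sz] := part_gt0 (leq_ltn_trans (leq0n _) lt); lia.
  have [|_ _ sz] := @part_gt0 la c a; rewrite -?E //; lia.
by rewrite b0 add1n ltnS /=; case/orP: H => /and4P[_ _ /eqP E _]; lia.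
Qed.

Lemma mem_ar_word la i g : (g \in ar_word v la i) =
  (addable la g || removable la g) && (residue e v g == i).
Proof.
rewrite mem_sort mem_filter; case: (boolP (_ || _)) => //= H.
by rewrite mem_box // andbT.
Qed.

(** Describes the effect of an operator through row lengths only, so that additions and removals are
    treated alike and can be read backwards. *)
Definition updates la a c k la' := [/\ (0 < a)%N, (c < l)%N &
  forall c' (j : int), part la' c' j = if (c' == c) && (j == a) then k else part la c' j].

Lemma set_row_updates la a c k : (0 < a)%N -> (c < l)%N ->
    (a == 1%N) || (k <= part la c a.-1)%N && (0 < part la c a.-1)%N ->
    (part la c a.+1 <= k)%N ->
  exists2 la', set_row la a c k = Some la' & updates la a c k la'.
Proof.
case: a => // a _ cl Hup Hdn.
rewrite /set_row; set t := (X in insub X).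
have mE c' : (c' < l)%N -> nth [::] t c' =
    if c' == c then set_part (mcomp la c) a.+1 k else mcomp la c'.
  move=> c'l; rewrite -(tnth_nth _ t (Ordinal c'l)) tnth_mktuple (tnth_nth [::]) /=.
  by case: eqP => [->|].
set s := mcomp la c in mE.
have sS : sorted geq (set_nth 0%N s a k).
  have /andP[/sorted_geqP H _] := is_part_mcomp la c.
  apply/sorted_geqP => j; rewrite !nth_set_nth /=.
  have [jE|ja1] := eqVneq j.+1 a.
    rewrite -jE eqn_leq ltnn andbF; case/orP: Hup; first by rewrite -jE.
    by rewrite -jE => /andP[].
  by have [->|_] := eqVneq j a; [exact: Hdn|exact: H].
have nE j : nth 0%N (set_part s a.+1 k) j = if j == a then k else nth 0%N s j.
  by rewrite nth_filter_gt0 // nth_set_nth.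
have tP : all is_part t.
  apply/(all_nthP [::]) => c'; rewrite size_tuple => c'l; rewrite mE //.
  case: eqP => _; last exact: is_part_mcomp.
  rewrite /is_part mem_filter ltnn andbT.
  by apply: sorted_filter sS => ? ? ? /= yx zy; exact: leq_trans zy yx.
rewrite insubT /=; eexists; first by [].
split=> // c' j; case: j => [[|j]|j] /=; rewrite ?andbF //.
rewrite /part eqz_nat eqSS {1}/mcomp SubK.
have [c'l|lc'] := ltnP c' l; last first.
  rewrite /mcomp !(nth_default [::]) ?size_tuple // nth_nil; case: eqP => // cc'.
  by move: cl; rewrite -cc' ltnNge lc'.
by rewrite mE //; case: eqP => [->|] //=; rewrite nE.
Qed.

Lemma add_node_updates la a b c : addable la (a, b, c) ->
  exists2 la', add_node la (a, b, c) = Some la' & updates la a c b la'.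
Proof.
rewrite addableE => /and4P[a0 cl /eqP-> H]; apply: set_row_updates => //.
  by case: (a == 1%N) H => //= lt; lia.
by apply: leqW; apply: part_le; lia.
Qed.

Lemma remove_node_updates la a b c : removable la (a, b, c) ->
  exists2 la', remove_node la (a, b, c) = Some la' & updates la a c b.-1 la'.
Proof.
rewrite removableE => /and4P[a0 b0 /eqP bE lt].
have [_ cl _] : [/\ (0 < a)%N, (c < l)%N & (a <= size (mcomp la c))%N].
  by apply: part_gt0; rewrite -bE.
apply: set_row_updates => //; last by lia.
have [->//|a1] := eqVneq a 1%N; apply/orP; right.
have : (part la c a <= part la c a.-1)%N by apply: part_le; lia.
lia.
Qed.

Definition nrows la := (\max_(c < l) size (mcomp la c))%N.

Lemma size_nrows la c : (size (mcomp la c) <= nrows la)%N.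
Proof.
have [cl|lc] := ltnP c l; last by rewrite /mcomp nth_default // size_tuple.
exact: (leq_bigmax (Ordinal cl)).
Qed.

(** * Sums over rows and the sums [S_(k,i)] of the associated multisegment *)

Section RowSum.
Variable V : zmodType.
Implicit Type F : nat -> nat -> nat -> V.

(** The bound [N] is free and empty rows are included, so that several multipartitions can share one
    index range. *)
Definition rowsum F la N := \sum_(0 <= c < l) \sum_(1 <= a < N) F c a (part la c a).

Lemma rowsum_updates F la a c k la' N : updates la a c k la' -> (a < N)%N ->
  rowsum F la' N = rowsum F la N + (F c a k - F c a (part la c a)).
Proof.
move=> [a0 cl E] aN; rewrite /rowsum.
rewrite (bigD1_seq c) ?mem_index_iota ?iota_uniq //=.
rewrite [in RHS](bigD1_seq c) ?mem_index_iota ?iota_uniq //=.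
rewrite [X in _ + X](eq_bigr (fun c' => \sum_(1 <= a < N) F c' a (part la c' a))); last first.
  by move=> c' /negbTE cc'; apply: eq_bigr => a' _; rewrite E cc'.
rewrite [RHS]addrAC; congr (_ + _).
rewrite (bigD1_seq a) ?mem_index_iota ?a0 ?iota_uniq //=.
rewrite [in RHS](bigD1_seq a) ?mem_index_iota ?a0 ?iota_uniq //=.
rewrite E !eqxx /= [RHS]addrAC [F c a (part _ _ _) + _]addrC subrK; congr (_ + _).
by apply: eq_bigr => a' /negbTE aa'; rewrite E eqz_nat aa' andbF.
Qed.

End RowSum.

Definition rseg c a k : seq 'Z_e := seg ((1 - a%:Z + v`_c)%:~R : 'Z_e) k.
(** The last residue of a row of length [k], and equally the residue of the node in column [k] of
    that row. *)
Definition rend c a k : 'Z_e := (k%:Z - a%:Z + v`_c)%:~R.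

Lemma rseg_to c a k : rseg c a k = seg_to k (rend c a k).
Proof.
rewrite /rseg /seg_to /rend; congr seg.
have -> : 1 - a%:Z + v`_c = (k%:Z - a%:Z + v`_c) - k%:Z + 1 by ring.
by rewrite rmorphD rmorphB.
Qed.

Lemma seg_to_rseg r i c a k : (0 < r)%N ->
  (seg_to r i == rseg c a k) = (r == k) && (i == rend c a k).
Proof.
move=> r0; rewrite rseg_to; apply/eqP/andP => [/(seg_to_inj r0)[-> ->]|[/eqP-> /eqP->]//].
by rewrite !eqxx.
Qed.

Lemma sum_fv (V : zmodType) (F : seq 'Z_e -> V) la N : (nrows la < N)%N ->
  \sum_(s <- (fv e v la : seq _)) F s =
  rowsum (fun c a k => if k == 0%N then 0 else F (rseg c a k)) la N.
Proof.
move=> MN; rewrite (perm_big _ (perm_eq_seq_mset _)) big_flatten big_map /rowsum /index_iota subn0.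
apply: eq_bigr => c _; rewrite big_map -/(index_iota 1 N).
have sN : (size (mcomp la c) < N)%N := leq_ltn_trans (size_nrows la c) MN.
rewrite [RHS](big_cat_nat (n := (size (mcomp la c)).+1)) //=.
rewrite [X in _ = _ + X]big1_seq ?addr0; last first.
  by move=> a /=; rewrite mem_index_iota => /andP[sa _]; rewrite part_out ?sa ?orbT.
rewrite /index_iota subn1 /=; apply: eq_big_seq => a; rewrite mem_iota => H.
by rewrite eqn0Ngt part_in // -ltnS.
Qed.

Lemma count_sum (T : eqType) (p : pred T) (s : seq T) :
  (count p s)%:Z = \sum_(x <- s) (p x : nat)%:Z.
Proof. by elim: s => [|x s IH]; rewrite ?big_nil // big_cons /= PoszD IH. Qed.

Lemma fv_count la N x : (nrows la < N)%N ->
  (fv e v la x)%:Z = rowsum (fun c a k => ((0 < k) && (x == rseg c a k))%N%:Z) la N.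
Proof.
move=> MN; rewrite -(count_mem_mset x) count_sum (sum_fv _ MN).
apply: eq_bigr => c _; apply: eq_bigr => a _.
by case: (part la c a) => //= k; rewrite eq_sym.
Qed.

Lemma mem_fv la c a : (0 < part la c a)%N -> rseg c a (part la c a) \in fv e v la.
Proof.
move=> p0; have [a0 cl asz] := part_gt0 p0.
rewrite (perm_mem (perm_eq_seq_mset _)); apply/flatten_mapP; exists c.
  by rewrite mem_iota.
by apply/mapP; exists a => //; rewrite mem_iota a0 add1n ltnS.
Qed.

(** The contribution of a row of length [m] to [S_(k,i)]. For [k = 0] empty rows contribute too, as
    the computation of the weight requires. *)
Definition end_term i k c a m : int :=
  (k <= m)%N%:Z * ((rend c a m == i - 1)%:Z - (rend c a m == i)%:Z).

(** After exchanging the sums, a row of length [m] meets the sum over [r] only at [r = m]. *)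
Lemma Sval_fv la i k N : (0 < k)%N -> (nrows la < N)%N ->
  Sval (fv e v la) i k = rowsum (end_term i k) la N.
Proof.
move=> k0 MN; rewrite (@Sval_wide _ _ _ _ (max_len (fv e v la)).+1) //.
under eq_bigr do rewrite !(fv_count _ MN) -sumrB.
rewrite exchange_big; apply: eq_bigr => c _.
under eq_bigr do rewrite -sumrB.
rewrite exchange_big; apply: eq_bigr => a _.
set m := part la c a.
transitivity (\sum_(k <= r < (max_len (fv e v la)).+1)
    (r == m)%:Z * ((rend c a m == i - 1)%:Z - (rend c a m == i)%:Z)).
  rewrite big_nat [RHS]big_nat; apply: eq_bigr => r /andP[kr _].
  have r0 : (0 < r)%N by lia.
  rewrite !seg_to_rseg // [i - 1 == _]eq_sym [i == _]eq_sym.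
  by have [<-|_] := eqVneq r m; rewrite ?r0 /= ?andbF ?mul1r ?mul0r.
rewrite -mulr_suml sum_nat_indicator; congr (_%:Z * _); congr (nat_of_bool _).
have [km|] := leqP k m; rewrite //= ?ltnS -(size_seg (rend c a m - m%:R + 1) m).
rewrite le_max_len // -/(seg_to _ _) -rseg_to mem_fv //; exact: leq_trans km.
Qed.

Lemma updates_grows la a b c la' : updates la a c b la' -> b = (part la c a).+1 ->
  grows (rend c a b) b (fv e v la) (fv e v la').
Proof.
move=> U bE; split=> [|x]; first by rewrite bE.
pose N := (nrows la + nrows la' + a).+1.
have [NN1 NN2 NN3] : [/\ nrows la < N, nrows la' < N & a < N]%N by rewrite /N; split; lia.
have := fv_count x NN2; rewrite (rowsum_updates _ U NN3) -(fv_count x NN1) -rseg_to.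
have -> : rend c a b - 1 = rend c a b.-1.
  rewrite /rend bE /=.
  have -> : (part la c a).+1%:Z - a%:Z + v`_c = ((part la c a)%:Z - a%:Z + v`_c) + 1 by lia.
  by rewrite rmorphD addrK.
rewrite -rseg_to bE /= ltnS => H.
by apply/eqP; rewrite -eqz_nat !PoszD H; apply/eqP; ring.
Qed.

End Rows.

(** * Heights of residue words *)

Section WordHeight.
Variables (e l : nat) (v : l.-tuple int).
Implicit Types (la : mpart l) (a b c k : nat) (i : 'Z_e).

(* On residue words of FLOTW l-partitions [prec] refines the order by levels, and
   [S_(k,i)] counts the nodes of level above [2 k].                           *)
Definition level la (g : node) : nat := (g.1.2.*2 + removable la g)%N.

Lemma residue_rend a b c : residue e v (a, b, c) = rend e v c a b.
Proof. by []. Qed.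

Lemma rendS c a b : rend e v c a b.+1 = rend e v c a b + 1.
Proof.
rewrite /rend; have -> : b.+1%:Z - a%:Z + v`_c = (b%:Z - a%:Z + v`_c) + 1 by lia.
by rewrite rmorphD.
Qed.

Lemma rend_next c a b : rend e v c a.+1 b = rend e v c a b - 1.
Proof.
rewrite /rend; have -> : b%:Z - a.+1%:Z + v`_c = (b%:Z - a%:Z + v`_c) - 1 by lia.
by rewrite rmorphB.
Qed.

Lemma addr1_eq (x y : 'Z_e) : (x + 1 == y) = (x == y - 1).
Proof. by rewrite [RHS]eq_sym subr_eq eq_sym. Qed.

Lemma sum_box (V : zmodType) (F : node -> V) la :
  \sum_(g <- box la) F g =
  \sum_(0 <= c < l) \sum_(a <- iota 1 (size (mcomp la c)).+1)
    \sum_(b <- iota 1 (part la c 1).+1) F (a, b, c).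
Proof.
rewrite big_flatten big_map /index_iota subn0; apply: eq_bigr => c _.
by rewrite big_allpairs_dep.
Qed.

Lemma sum_eq_uniq (V : zmodType) (T : eqType) (s : seq T) x (y : V) (P : pred T) :
  uniq s -> (P x -> x \in s) -> (forall z, P z -> z = x) ->
  \sum_(z <- s) (if P z then y else 0) = if P x then y else 0.
Proof.
move=> us xs Px; case: ifP => [Pxx|nPx].
  rewrite (bigD1_seq x) ?xs //= Pxx big1 ?addr0 // => z zx.
  by case: ifP => // /Px zE; rewrite zE eqxx in zx.
by rewrite big1 // => z _; case: ifP => // Pz; rewrite -(Px _ Pz) Pz in nPx.
Qed.

(* A row equal to the row above it has no addable node and that one has no
   removable node; the two missing contributions cancel, up to the rows of
   length 0, which matter only for [k = 0].                                   *)
Lemma height_ar_word la i k N : (nrows la + 2 <= N)%N ->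
  height (removable la) (addable la) (fun x => k.*2 < level la x)%N (ar_word v la i) =
  rowsum (end_term v i k) la N +
  (k == 0%N)%:Z * \sum_(0 <= c < l) (i == (v`_c - N%:Z + 1)%:~R)%:Z.
Proof.
move=> MN; rewrite /height (perm_big _ (permEl (perm_sort _ _))) big_filter_cond.
(* By the parity in [level], the threshold reads [k < b] for addable nodes and [k <= b] for
   removable ones. *)
transitivity (\sum_(g <- box la)
   ((if [&& addable la g, residue e v g == i & k < g.1.2]%N then 1 else 0) -
    (if [&& removable la g, residue e v g == i & k <= g.1.2]%N then 1 else 0) : int)).
  rewrite big_mkcond /=; apply: eq_bigr => g _; rewrite /level.
  have := @addable_notR l la g.
  case: (addable la g) => [/(_ isT)->|_] /=.
    by rewrite addn0 ltn_double; case: (_ && _).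
  case: (removable la g) => /=; last by rewrite subrr.
  by rewrite addn1 ltnS leq_double andbC; case: (_ && _).
rewrite sum_box /rowsum mulr_sumr -big_split.
apply: eq_big_seq => c; rewrite mem_index_iota => /andP[_ cl].
pose A a := (if [&& (0 < a)%N, (a == 1%N) || (part la c a < part la c a.-1)%N,
                 rend e v c a (part la c a) == i - 1 & (k <= part la c a)%N] then 1 else 0) : int.
pose R a := (if [&& (0 < part la c a)%N, (part la c a.+1 < part la c a)%N,
                 rend e v c a (part la c a) == i & (k <= part la c a)%N] then 1 else 0) : int.
transitivity (\sum_(a <- iota 1 (size (mcomp la c)).+1) (A a - R a)).
  apply: eq_big_seq => a; rewrite mem_iota => /andP[a0 aN].
  have le1 : (part la c a <= part la c 1)%N by apply: part_le; lia.
  rewrite sumrB; congr (_ - _).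
    rewrite (@sum_eq_uniq _ _ _ (part la c a).+1) ?iota_uniq //.
    - rewrite addableE cl a0 eqxx residue_rend rendS addr1_eq ltnS.
      by rewrite /A a0.
    - by rewrite mem_iota; lia.
    - by move=> b; rewrite addableE => /andP[/and4P[_ _ /eqP-> _] _].
  rewrite (@sum_eq_uniq _ _ _ (part la c a)) ?iota_uniq //.
  - by rewrite removableE a0 eqxx residue_rend andTb -!andbA /R.
  - by rewrite removableE mem_iota; lia.
  - by move=> b; rewrite removableE => /andP[/and4P[_ _ /eqP-> _] _].
have MNc : ((size (mcomp la c)).+2 <= N)%N.
  by apply: leq_trans MN; rewrite addn2 !ltnS size_nrows.
transitivity (\sum_(1 <= a < N) (A a - R a)).
  rewrite [RHS](big_cat_nat (n := (size (mcomp la c)).+2)) //=.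
  rewrite [X in _ = _ + X]big1_seq ?addr0; last first.
    move=> a /=; rewrite mem_index_iota => /andP[sa _]; rewrite /A /R.
    have -> : part la c a = 0%N by apply: part_out; apply/orP; right; lia.
    have -> : part la c a.-1 = 0%N by apply: part_out; apply/orP; right; lia.
    have -> : (a == 1%N) = false by lia.
    by rewrite ltnn /= andbF subrr.
  by rewrite /index_iota subn1.
(* [T a] marks equal rows [a - 1] and [a] for which an A is missing in row [a] and, unless they are
   empty, an R in row [a - 1]. It enters once with each sign and telescopes. *)
pose T a := ([&& (1 < a)%N, part la c a.-1 == part la c a, (k <= part la c a)%N
                & rend e v c a (part la c a) == i - 1] : nat)%:Z.
transitivity (\sum_(1 <= a < N) (end_term v i k c a (part la c a) + (T a.+1 - T a))).
  rewrite big_nat [RHS]big_nat; apply: eq_bigr => a /andP[a0 _].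
  have TE : T a.+1 = [&& part la c a == part la c a.+1, (k <= part la c a)%N
                        & rend e v c a (part la c a) == i]%:Z.
    rewrite /T rend_next (inj_eq (addIr _)) ltnS a0 /=.
    by case: eqVneq => [->|].
  have le1 : (part la c a.+1 <= part la c a)%N by apply: part_le; lia.
  have le2 : (1 < a)%N -> (part la c a <= part la c a.-1)%N.
    by move=> a1; apply: part_le; lia.
  have bE (b : bool) : (if b then 1 else 0 : int) = b%:Z by case: b.
  rewrite TE /A /R /T /end_term !bE; move: le1 le2.
  move: (part la c a) (part la c a.+1) (part la c a.-1) => p q r.
  case: (rend _ _ _ _ _ == i - 1); case: (rend _ _ _ _ _ == i); case: (leqP k p) => kp /=; lia.
(* What is left is [T N], which compares two empty rows and is nonzero only for [k = 0]. *)
rewrite big_split telescope_sumr; last by lia.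
rewrite /T ltnn /= subr0; congr (_ + _).
have -> : part la c N = 0%N by apply: part_out; apply/orP; right; lia.
have -> : part la c N.-1 = 0%N by apply: part_out; apply/orP; right; lia.
have -> : (1 < N)%N by lia.
rewrite leqn0 eqxx /= [rend _ _ _ _ _ == _]eq_sym subr_eq /rend.
have -> : (0%:Z - N%:Z + v`_c)%:~R + 1 = (v`_c - N%:Z + 1)%:~R :> 'Z_e.
  by rewrite -[1 in LHS](rmorph1 (intmul 1)) -rmorphD; congr _%:~R; lia.
by case: (k == 0%N); case: (_ == _).
Qed.

(** Each row contributes boundary terms at its two ends. The right ends give the end terms; the left
    ends telescope down the rows of a component, cancel the fundamental weight and leave a term at
    row [N]. *)
Lemma pairing_sum la i N : (nrows la < N)%N ->
  pairing (mseg_wt (fv e v la) + Lambda e v) i =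
  rowsum (end_term v i 0) la N +
  \sum_(0 <= c < l) (i == (v`_c - N%:Z + 1)%:~R)%:Z.
Proof.
move=> MN; rewrite /pairing /= ffunE /mseg_wt /= ffunE.
rewrite (sum_fv v _ MN) /rowsum.
have fstE (s : seq nat) (F : nat -> weight e) :
    (\sum_(c <- s) F c).1 i = \sum_(c <- s) (F c).1 i.
  by elim: s => [|x s IH]; rewrite ?big_nil ?big_cons ffunE // IH.
have -> : (Lambda e v).1 i = \sum_(0 <= c < l) (i == (v`_c)%:~R)%:Z.
  rewrite /Lambda (big_nth 0) size_tuple fstE; apply: eq_bigr => c _.
  by rewrite ffunE; case: eqP.
rewrite fstE -sumrN -!big_split; apply: eq_bigr => c _ /=.
rewrite fstE.
transitivity (\sum_(1 <= a < N) (end_term v i 0 c a (part la c a) +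
   ((i == (v`_c - a.+1%:Z + 1)%:~R)%:Z - (i == (v`_c - a%:Z + 1)%:~R)%:Z))
   + (i == (v`_c)%:~R)%:Z).
  congr (_ + _); rewrite -sumrN; apply: eq_bigr => a _.
  set m := part la c a.
  transitivity (- (\sum_(x <- rseg e v c a m) simple_root x).1 i).
    by case: (m) => //=; rewrite big_nil.
  rewrite sum_root_seg /end_term mul1r.
  have -> : (1 - a%:Z + v`_c)%:~R + m%:R - 1 = rend e v c a m.
    rewrite /rend; have -> : m%:Z - a%:Z + v`_c = (1 - a%:Z + v`_c) + m%:Z - 1 by ring.
    by move: (1 - a%:Z + v`_c) => s; rewrite rmorphB rmorphD.
  have -> : (1 - a%:Z + v`_c)%:~R + m%:R = rend e v c a m + 1.
    rewrite /rend; have -> : m%:Z - a%:Z + v`_c = (1 - a%:Z + v`_c) + m%:Z - 1 by ring.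
    by move: (1 - a%:Z + v`_c) => s; rewrite rmorphB rmorphD subrK.
  have -> : (v`_c - a.+1%:Z + 1)%:~R = (1 - a%:Z + v`_c)%:~R - 1 :> 'Z_e.
    have -> : v`_c - a.+1%:Z + 1 = (1 - a%:Z + v`_c) - 1 by lia.
    by move: (1 - a%:Z + v`_c) => s; rewrite rmorphB.
  have -> : v`_c - a%:Z + 1 = 1 - a%:Z + v`_c by ring.
  rewrite [i == rend _ _ _ _ _ + 1]eq_sym addr1_eq [i == rend _ _ _ _ _]eq_sym.
  ring.
rewrite big_split telescope_sumr; last by lia.
rewrite subrK -addrA subrK; congr (_ + _).
Qed.

Lemma fv_wt la : mpart_wt e v la = mseg_wt (fv e v la) + Lambda e v.
Proof.
rewrite /mpart_wt addrC; congr (_ + _); rewrite /mseg_wt; congr (- _).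
have countE (s : seq node) (P : pred node) :
    \sum_(i : 'Z_e) simple_root i *+ count (fun g => P g && (residue e v g == i)) s =
    \sum_(g <- s | P g) simple_root (residue e v g).
  elim: s => [|g s IH]; first by rewrite big_nil big1.
  rewrite big_cons -IH /=; case: (P g) => /=.
    under eq_bigr do rewrite mulrnDr.
    rewrite big_split /=; congr (_ + _).
    rewrite (bigD1 (residue e v g)) //= eqxx big1 ?addr0 // => i.
    by rewrite eq_sym => /negbTE->.
  by apply: eq_bigr.
rewrite countE big_mkcond (sum_fv v _ (leqnn _)) sum_box.
apply: eq_big_seq => c; rewrite mem_index_iota => /andP[_ cl].
have sN : (size (mcomp la c) <= nrows la)%N := size_nrows la c.
rewrite -/(index_iota 1 (nrows la).+1).
rewrite [RHS](big_cat_nat (n := (size (mcomp la c)).+1)) //.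
rewrite [X in _ = _ + X]big1_seq ?addr0; last first.
  by move=> a /andP[_]; rewrite mem_index_iota => /andP[sa _]; rewrite part_out ?sa ?orbT.
rewrite -[X in iota 1 X]addn1 iotaD big_cat big_seq1.
rewrite [X in _ + X = _]big1 ?addr0; last first.
  move=> b _; rewrite /in_diag (part_out (a := (1 + _)%N)) ?add1n ?leqnn ?orbT //.
  by case: b => [|b]; rewrite ?andbF.
rewrite /index_iota subn1; apply: eq_big_seq => a; rewrite mem_iota => /andP[a0 _].
have le1 : (part la c a <= part la c 1)%N by apply: part_le; lia.
set m := part la c a.
transitivity (\sum_(1 <= b < m.+1) simple_root (residue e v (a, b, c))).
  rewrite (big_nat_widen 1 m.+1 (part la c 1).+2); last by rewrite ltnS leqW.
  rewrite [RHS]big_mkcond /index_iota subn1.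
  apply: eq_big_seq => b; rewrite mem_iota => /andP[b0 _].
  by rewrite /in_diag a0 b0 /= ltnS.
transitivity (\sum_(x <- rseg e v c a m) simple_root x); last first.
  by case: (m) => //; rewrite big_nil.
rewrite big_map big_add1 /index_iota subn0; apply: eq_bigr => t _.
congr simple_root; rewrite /residue /content.
have -> : t.+1%:Z - a%:Z + v`_c = (1 - a%:Z + v`_c) + t%:Z by lia.
by move: (1 - a%:Z + v`_c) => s; rewrite rmorphD.
Qed.

End WordHeight.

(** * FLOTW multipartitions *)

Section NodeOrder.
Variables (e l : nat) (v : l.-tuple int).
Implicit Types (la : mpart l) (b c k : nat) (i : 'Z_e) (g : node).

Lemma prec_irr : irreflexive (prec v).
Proof. by move=> g; rewrite /prec ltxx ltnn andbF. Qed.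

Lemma prec_trans : transitive (prec v).
Proof. by move=> g2 g1 g3; rewrite /prec; lia. Qed.

Lemma uniq_flatten_map (S T : eqType) (f : S -> seq T) (h : T -> S) (s : seq S) :
  uniq s -> (forall y, uniq (f y)) -> (forall y x, x \in f y -> h x = y) ->
  uniq (flatten (map f s)).
Proof.
move=> us uf hf; elim: s us => //= c s IH /andP[cs /IH us].
rewrite cat_uniq uf us andbT; apply/hasPn => x /flatten_mapP[c' c's xc'].
by apply/negP => xc; case/negP: cs; rewrite -(hf _ _ xc) (hf _ _ xc').
Qed.

Lemma uniq_box la : uniq (box la).
Proof.
apply: (uniq_flatten_map (h := fun g : node => g.2)); first exact: iota_uniq.
  move=> c; apply: allpairs_uniq; rewrite ?iota_uniq //.
  by move=> [a b] [a' b'] _ _ [-> ->].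
by move=> c g /allpairsP[x [_ _ ->]].
Qed.

Lemma prec_total la g g' : addable la g || removable la g ->
  addable la g' || removable la g' -> ~~ prec v g' g -> g != g' -> prec v g g'.
Proof.
case: g g' => -[a b] c [[a' b'] c'] H H'; rewrite /prec negb_or -leNgt negb_and -leqNgt /=.
move=> /andP[le ord] ne; rewrite lt_neqAle le andbT.
have [E|//] := eqVneq; rewrite E eqxx /= in ord *; move: ord => cc'.
rewrite ltn_neqAle cc' andbT; apply/eqP => ccE; case/negP: ne; rewrite {}ccE in H' E *.
(* A diagonal of one component carries at most one addable or removable node. *)
have diag x y x' y' : addable la (x, y, c) || removable la (x, y, c) ->
    addable la (x', y', c) || removable la (x', y', c) ->
    y'%:Z - x'%:Z = y%:Z - x%:Z -> (x < x')%N -> False.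
  rewrite !addableE !removableE => K K' E' xx'.
  have le1 : (0 < x)%N -> (part la c x.+1 <= part la c x)%N by move=> x0; apply: part_le; lia.
  have le2 : (part la c x' <= part la c x.+1)%N by apply: part_le; lia.
  lia.
have aa' : a = a'.
  case: (ltngtP a a') => // lt.
    by case: (diag _ _ _ _ H H' _ lt); lia.
  by case: (diag _ _ _ _ H' H _ lt); lia.
by apply/eqP; congr (_, _, _) => //; lia.
Qed.

Lemma level_gt0 la g : addable la g || removable la g -> (0 < level la g)%N.
Proof.
case: g => -[a b] c; rewrite /level [X in X.*2]/= addableE removableE => H.
have b0 : (0 < b)%N by lia.
by rewrite ltn_addr // double_gt0.
Qed.

Section Word.
Variables (la : mpart l) (i : 'Z_e).

Let w := ar_word v la i.

Let memw g : g \in w = (addable la g || removable la g) && (residue e v g == i).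
Proof. exact: mem_ar_word. Qed.

Lemma ar_word_sorted : pairwise (prec v) w.
Proof.
pose r g1 g2 := ~~ prec v g2 g1.
have rtrans : transitive r by move=> g2 g1 g3; rewrite /r /prec; lia.
have rtot : total r by move=> g1 g2; rewrite /r /prec; lia.
have sw : pairwise r w by rewrite -sorted_pairwise // sort_sorted.
have uw : uniq w by rewrite sort_uniq filter_uniq ?uniq_box.
have mw g : g \in w -> addable la g || removable la g by rewrite memw => /andP[].
elim: (w) sw uw mw => //= g s IH /andP[gs ss] /andP[gns us] mw.
rewrite IH // ?andbT; last by move=> g' g's; apply: mw; rewrite inE g's orbT.
apply/allP => g' g's; apply: (@prec_total la).
- by apply: mw; rewrite mem_head.
- by apply: mw; rewrite inE g's orbT.
- exact: (allP gs).
- by apply: contraNneq gns => ->.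
Qed.

Lemma level_odd : {in w, forall g, removable la g = odd (level la g)}.
Proof. by move=> g _; rewrite /level oddD odd_double; case: removable. Qed.

Lemma level_even : {in w, forall g, addable la g = ~~ odd (level la g)}.
Proof.
move=> g gw; rewrite -level_odd //; move: gw; rewrite memw => /andP[+ _].
by have := @addable_notR l la g; case: addable => [->|_ /= ->].
Qed.

Lemma height_Sval k : (0 < k)%N ->
  height (removable la) (addable la) (fun g => k.*2 < level la g)%N w =
  Sval (fv e v la) i k.
Proof.
move=> k0; rewrite (@Sval_fv _ _ _ _ _ _ (nrows la + 2)) //; last by lia.
by rewrite (height_ar_word v i k (leqnn (nrows la + 2)%N)) eqn0Ngt k0 mul0r addr0.
Qed.

Definition unmatched_rem := count (removable la) (reduced_word v la i).
Definition unmatched_add := count (addable la) (reduced_word v la i).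

(** Deleting pairs preserves the number of A minus the number of R. Levels are positive, so
    threshold 0 keeps the whole word, and the height at [k = 0] is the expression found for the
    weight. *)
Lemma unmatched_diff :
  unmatched_add%:Z - unmatched_rem%:Z = pairing (mpart_wt e v la) i.
Proof.
have MN : (nrows la < nrows la + 2)%N by lia.
rewrite fv_wt (pairing_sum v i MN).
have := height_ar_word v i 0 (leqnn (nrows la + 2)%N); rewrite mul1r => <-.
rewrite /unmatched_add /unmatched_rem /reduced_word.
rewrite (count_reduce ar_word_sorted level_odd level_even).
rewrite /height big_seq_cond [RHS]big_seq_cond; apply: eq_bigl => g.
rewrite andbT; apply/idP/idP => [gw|/andP[] //]; rewrite gw.
by apply: level_gt0; move: gw; rewrite memw => /andP[].
Qed.

End Word.
End NodeOrder.

(** * The dominance order on rows *)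

Section Flotw.
Variables (e l : nat) (v : l.-tuple int).
Hypotheses (he : (2 <= e)%N) (hl : (0 < l)%N) (hv : in_V e v).
Implicit Types (la : mpart l) (b c k : nat) (i : 'Z_e) (g : node).

Lemma Zint_eq (x y : int) : x%:~R = y%:~R :> 'Z_e ->
  x = y \/ x + e%:Z <= y \/ y + e%:Z <= x.
Proof.
have dvd n : n%:R = 0 :> 'Z_e -> n = 0%N \/ (e <= n)%N.
  move=> /(congr1 val); rewrite /= val_Zp_nat // => /eqP; rewrite -/(dvdn e n).
  by case: n => [|n]; [left|move=> /dvdn_leq; right; auto].
move=> /eqP; rewrite -subr_eq0 -rmorphB => /eqP xy.
have [xy0|yx0] := lerP 0 (x - y).
  have : (`|x - y|%N)%:R = 0 :> 'Z_e by rewrite -xy -{2}(gez0_abs xy0).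
  by move/dvd; lia.
have : (`|x - y|%N)%:R = 0 :> 'Z_e.
  rewrite -[RHS]oppr0 -xy -rmorphN -[in RHS](gez0_abs (_ : 0 <= - (x - y))); last by lia.
  by rewrite abszN.
by move/dvd; lia.
Qed.

Lemma v_le c c' : (c <= c' < l)%N -> v`_c <= v`_c'.
Proof.
case/andP => cc' c'l; have [vs _] := hv.
by apply: (sorted_leq_nth le_trans lexx 0 vs) => //; rewrite inE size_tuple //; lia.
Qed.

Lemma v_lt c c' : (c < l)%N -> (c' < l)%N -> v`_c' < v`_c + e%:Z.
Proof.
move=> cl c'l; have [_] := hv; rewrite -nth_last -nth0 size_tuple => vl.
have := @v_le 0 c; have := @v_le c' l.-1; lia.
Qed.

(** Up to a constant, [a - v_c] is minus the content of the first node of row [a] in component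
    [c]. *)
Definition dominates c (a : int) c' (a' : int) : bool :=
  ((c <= c')%N && (a - v`_c <= a' - v`_c')) || (a - v`_c + e%:Z <= a' - v`_c').

(** Chain the inequalities between neighbouring components ([up]), passing at most once from the
    last component to the first ([wrap]). Monotonicity of parts absorbs the remaining shift. *)
Lemma flotw_dominates la c c' (a a' : int) : flotw e v la -> (c < l)%N -> (c' < l)%N ->
  1 <= a -> dominates c a c' a' -> (part la c' a' <= part la c a)%N.
Proof.
move=> [fl1 fl2 _].
have up d d' (x : int) : (d <= d' < l)%N -> 1 <= x ->
    (part la d' (x + v`_d' - v`_d) <= part la d x)%N.
  case/andP => dd' d'l x1; rewrite -(subnKC dd') in d'l *.
  elim: (d' - d)%N d'l => [|n IH] d'l; first by rewrite addn0 addrK.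
  have nl : (d + n < l)%N by lia.
  apply: leq_trans (IH nl); rewrite addnS.
  have := @v_le d (d + n); rewrite leq_addr nl => /(_ isT) vd.
  have := fl1 (d + n)%N (x + v`_(d + n) - v`_d); rewrite -addnS => /(_ d'l).
  have -> : x + v`_(d + n) - v`_d + v`_(d + n.+1) - v`_(d + n) = x + v`_(d + n.+1) - v`_d by lia.
  by apply; lia.
have wrap d d' (x : int) : (d < l)%N -> (d' < l)%N -> 1 <= x ->
    (part la d' (x + e%:Z + v`_d' - v`_d) <= part la d x)%N.
  move=> dl d'l x1; have dm : (d <= l.-1 < l)%N by lia.
  have vm := v_le dm; have v0 := v_lt hl dl.
  have := up d l.-1 x dm x1; apply: leq_trans.
  have := fl2 (x + v`_l.-1 - v`_d).
  have -> : x + v`_l.-1 - v`_d + e%:Z + v`_0 - v`_l.-1 = x + e%:Z + v`_0 - v`_d by lia.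
  move=> /(_ ltac:(lia)); apply: leq_trans.
  have := up 0%N d' (x + e%:Z + v`_0 - v`_d); rewrite leq0n d'l => /(_ isT).
  have -> : x + e%:Z + v`_0 - v`_d + v`_d' - v`_0 = x + e%:Z + v`_d' - v`_d by lia.
  by apply; lia.
move=> cl c'l a1 /orP[/andP[cc' le]|le].
  have cc : (c <= c' < l)%N by rewrite cc'.
  apply: leq_trans (up _ _ _ cc a1); have := v_le cc => vv.
  by apply: part_le; lia.
apply: leq_trans (wrap _ _ _ cl c'l a1).
by have := v_lt c'l cl => vv; apply: part_le; lia.
Qed.

Lemma flotwI la : aperiodic (fv e v la) ->
    (forall c c' (a a' : int), (c < l)%N -> (c' < l)%N -> 1 <= a -> 1 <= a' ->
      ((c < c')%N && (a - v`_c == a' - v`_c')) || (a - v`_c + e%:Z == a' - v`_c') ->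
      (part la c' a' <= part la c a)%N) ->
  flotw e v la.
Proof.
move=> [_ ap] dom; split=> [c j cl j1|j j1|k k0 full].
- have := @v_le c c.+1; rewrite leqnSn cl => /(_ isT) vv.
  by apply: dom => //; lia.
- have vv := @v_lt 0 l.-1 hl ltac:(lia).
  have vv' := @v_lt l.-1 0 ltac:(lia) hl.
  by apply: dom => //; lia.
- have [i] := ap k k0; apply/negP/negPn.
  (* The residue [i + k - 1] is the end of the missing segment [[i; k)]. *)
  have [[[|a]|a] [c [//= _ cl pk rE]]] := full (i + k%:R - 1).
  have p0 : (0 < part la c a.+1)%N by rewrite pk.
  have := mem_fv e v p0; rewrite rseg_to pk /seg_to /rend rE.
  by have -> : i + k%:R - 1 - k%:R + 1 = i by ring.
Qed.

(** Otherwise the row of [g] dominates that of [g'], and if [b < b'] so does the row just below [g].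
    The row lengths forced by the letters A and R contradict one of these two inequalities. *)
Lemma ar_word_prec la i : flotw e v la ->
  {in ar_word v la i &, forall g g', (level la g < level la g')%N -> prec v g g'}.
Proof.
set w := ar_word v la i => fla.
suff main (a b c a' b' c' : nat) : (a, b, c) \in w -> (a', b', c') \in w ->
    (level la (a, b, c) < level la (a', b', c'))%N -> prec v (a, b, c) (a', b', c').
  by move=> [[a b] c] [[a' b'] c']; exact: main.
rewrite !mem_ar_word => /andP[H /eqP resg] /andP[H' /eqP resg'].
move=> lt; apply/negPn/negP => nprec.
have cE : b'%:Z - a'%:Z + v`_c' = b%:Z - a%:Z + v`_c \/
          b'%:Z - a'%:Z + v`_c' + e%:Z <= b%:Z - a%:Z + v`_c.
  have := Zint_eq (etrans resg' (esym resg)); move: nprec.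
  rewrite /prec /=; lia.
have cc : b'%:Z - a'%:Z + v`_c' = b%:Z - a%:Z + v`_c -> (c <= c')%N.
  by move=> E; move: nprec; rewrite /prec /= E ltxx eqxx -leqNgt.
have Rg := @addable_notR l la (a, b, c); have Rg' := @addable_notR l la (a', b', c').
have bb' : (b <= b')%N.
  by clear -lt; move: lt; rewrite /level [X in X.*2]/= [X in (_ < X.*2 + _)%N]/=; lia.
move: H H' Rg Rg' lt; rewrite /level [X in X.*2]/= [X in (_ < X.*2 + _)%N]/=.
rewrite !addableE !removableE => H H' Rg Rg' lt.
have cl : (c < l)%N.
  by case/orP: H => /and4P[a0 x /eqP E _] //; have [] := @part_gt0 l la c a; rewrite -?E.
have c'l : (c' < l)%N.
  by case/orP: H' => /and4P[a0 x /eqP E _] //; have [] := @part_gt0 l la c' a'; rewrite -?E.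
have a0 : (0 < a)%N by lia.
have dom1 : (part la c' a' <= part la c a)%N.
  by apply: flotw_dominates => //; clear -cE cc bb' he; rewrite /dominates; lia.
have dom2 : (b < b')%N -> (part la c' a' <= part la c a.+1)%N.
  by move=> lt'; apply: flotw_dominates => //; clear -cE cc lt' he; rewrite /dominates; lia.
clear -H H' Rg Rg' lt dom1 dom2; lia.
Qed.

End Flotw.

(** * Crystal operators on FLOTW multipartitions *)

Section CrystalOperators.
Variables (e l : nat) (v : l.-tuple int).
Hypotheses (he : (2 <= e)%N) (hl : (0 < l)%N) (hv : in_V e v).
Implicit Types (la : mpart l) (b c k : nat) (i : 'Z_e) (g : node).

Lemma rem_le_Sval la i k : flotw e v la -> (0 < k)%N ->
  - (unmatched_rem v la i)%:Z <= Sval (fv e v la) i k.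
Proof.
move=> fla k0; rewrite -height_Sval //.
exact: (unmatched_le (@prec_trans _ v) (@prec_irr _ v) (ar_word_sorted _ _ _)
  (ar_word_prec he hl hv fla) (@level_odd _ _ _ _ _) (@level_even _ _ _ _ _)).
Qed.

Lemma reduced_removable la i a b c : flotw e v la ->
    ohead [seq g <- reduced_word v la i | removable la g] = Some (a, b, c) ->
  [/\ (a, b, c) \in ar_word v la i, removable la (a, b, c),
      (0 < unmatched_rem v la i)%N, last_min (fv e v la) i b
    & Sval (fv e v la) i b = - (unmatched_rem v la i)%:Z].
Proof.
move=> fla hd.
have [u [u' [E _ Rg _]]] := first_removable
  (@level_odd _ _ _ _ _) (@level_even _ _ _ _ _) hd.
have gw : (a, b, c) \in ar_word v la i.
  apply: (mem_subseq (reduce_RA_subseq (removable la) (addable la) _)).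
  by rewrite E mem_cat mem_head orbT.
have b0 : (0 < b)%N by move: Rg; rewrite removableE => /and4P[].
have lev : level la (a, b, c) = b.*2.+1 by rewrite /level Rg addn1.
have [y0 Sb Sk] := first_removableP (@prec_trans _ v) (@prec_irr _ v) (ar_word_sorted _ _ _)
  (ar_word_prec he hl hv fla) (@level_odd _ _ _ _ _) (@level_even _ _ _ _ _) hd lev.
have SbE : Sval (fv e v la) i b = - (unmatched_rem v la i)%:Z by rewrite -height_Sval.
split=> //; split=> // r r0; rewrite SbE; first exact: rem_le_Sval.
by rewrite -height_Sval ?Sk //; apply: leq_trans r0.
Qed.

Lemma reduced_addable la i a b c : flotw e v la ->
    ohead (rev [seq g <- reduced_word v la i | addable la g]) = Some (a, b, c) ->
  [/\ (a, b, c) \in ar_word v la i, addable la (a, b, c),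
      (0 < unmatched_add v la i)%N & ell0 (fv e v la) i = b].
Proof.
move=> fla hd.
have [u [u' [E _ Ag _]]] := last_addable
  (@level_odd _ _ _ _ _) (@level_even _ _ _ _ _) hd.
have gw : (a, b, c) \in ar_word v la i.
  apply: (mem_subseq (reduce_RA_subseq (removable la) (addable la) _)).
  by rewrite E mem_cat mem_head orbT.
have b0 : (0 < b)%N by move: Ag; rewrite addableE => /and4P[_ _ /eqP->].
have lev : level la (a, b, c) = b.*2 by rewrite /level addable_notR // addn0.
have [x0 Sb Sk] := last_addableP (@prec_trans _ v) (@prec_irr _ v) (ar_word_sorted _ _ _)
  (ar_word_prec he hl hv fla) (@level_odd _ _ _ _ _) (@level_even _ _ _ _ _) hd lev.
have SbE : Sval (fv e v la) i b = - (unmatched_rem v la i)%:Z by rewrite -height_Sval.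
split=> //; apply: ell0_eq => // r; rewrite SbE; first exact: rem_le_Sval.
by case/andP=> r0 rb; rewrite -height_Sval // Sk.
Qed.

Lemma mseg_eps_fv la i : flotw e v la ->
  mseg_eps (fv e v la) i = (unmatched_rem v la i)%:Z.
Proof.
move=> fla; case hd: (ohead [seq g <- reduced_word v la i | removable la g]) => [[[a b] c]|].
  have [_ _ _ [b0 bmin _] Sb] := reduced_removable fla hd.
  by rewrite (mseg_eps_eq b0 bmin) Sb opprK.
have y0 : unmatched_rem v la i = 0%N.
  by rewrite /unmatched_rem -size_filter; case: filter hd.
apply/eqP; rewrite y0 eq_le; apply/andP; split; last exact: mseg_eps_ge0.
have := rem_le_Sval i fla (isT : 0 < ell0 (fv e v la) i)%N.
by rewrite y0 oppr0 /mseg_eps oppr_le0.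
Qed.

(** The extreme cases of dominance, to which [flotwI] reduces the inequalities. Nodes of one column
    in twin rows have equal residues, and the one in the dominated row comes first in the word. *)
Definition twin c (a : int) c' (a' : int) : bool :=
  ((c < c')%N && (a - v`_c == a' - v`_c')) || (a - v`_c + e%:Z == a' - v`_c').

Lemma twin_dominates c a c' a' : twin c a c' a' -> dominates e v c a c' a'.
Proof. by rewrite /twin /dominates; lia. Qed.

Lemma twin_residue (a a' b c c' : nat) : twin c a c' a' ->
  residue e v (a', b, c') = residue e v (a, b, c).
Proof.
move=> tw; rewrite /residue /content.
have [->|->] : b%:Z - a'%:Z + v`_c' = b%:Z - a%:Z + v`_c \/
    b%:Z - a'%:Z + v`_c' = b%:Z - a%:Z + v`_c - e%:Z by move: tw; rewrite /twin; lia.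
- by [].
- by move: (_ - _ + _) => x; rewrite rmorphB /= [e%:Z%:~R](pchar_Zp he) subr0.
Qed.

Lemma twin_prec (a a' b c c' : nat) : twin c a c' a' -> prec v (a', b, c') (a, b, c).
Proof. by rewrite /twin /prec /=; lia. Qed.

Lemma remove_flotw la i a b c la' : flotw e v la ->
    ohead [seq g <- reduced_word v la i | removable la g] = Some (a, b, c) ->
    updates la a c b.-1 la' -> aperiodic (fv e v la') -> flotw e v la'.
Proof.
move=> fla hd [a0 cl U] ap; have [gw Rg _ _ _] := reduced_removable fla hd.
have [b0 bE lt] : [/\ 0 < b, b = part la c a & part la c a.+1 < b]%N.
  by move: Rg; rewrite removableE => /and4P[_ b0 /eqP bE lt].
apply: (flotwI he hl hv ap) => d d' x x' dl d'l x1 x'1 tw.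
have := flotw_dominates he hl hv fla dl d'l x1 (twin_dominates tw).
rewrite !U; case: (boolP ((d == c) && (x == a))) => [/andP[/eqP dc /eqP xa]|_]; last first.
  by case: ifP => // /andP[/eqP-> /eqP->]; apply: leq_trans; rewrite -bE leq_pred.
rewrite {}dc {}xa -bE in x1 tw dl *; case: ifP => [/andP[/eqP d'c /eqP x'a]|_ le].
  by move: tw; rewrite d'c x'a; lia.
case: x' x'1 tw le => [a'|//] a'1 tw le.
rewrite -ltnS prednK // ltn_neqAle le andbT; apply/negP => /eqP pb.
(* The twin row also has length [b], and the row below it is dominated by the row below row [a]. So
   its last node is removable, in the same column and earlier in the word. *)
have le' : (part la d' a'.+1 <= part la c a.+1)%N.
  by apply: (flotw_dominates he hl hv fla) => //; move: tw; rewrite /dominates; lia.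
have Rg' : removable la (a', b, d').
  by rewrite removableE b0 pb eqxx (leq_ltn_trans le' lt) andbT; lia.
have g'w : (a', b, d') \in ar_word v la i.
  rewrite mem_ar_word Rg' orbT (twin_residue b tw).
  by move: gw; rewrite mem_ar_word => /andP[].
apply: (no_removable_twin (@prec_trans _ v) (@prec_irr _ v) (ar_word_sorted _ _ _)
  (ar_word_prec he hl hv fla) (@level_odd _ _ _ _ _) (@level_even _ _ _ _ _) hd g'w Rg').
  exact: twin_prec.
by rewrite /level Rg Rg'.
Qed.

Lemma add_flotw la i a b c la' : flotw e v la ->
    ohead (rev [seq g <- reduced_word v la i | addable la g]) = Some (a, b, c) ->
    updates la a c b la' -> aperiodic (fv e v la') -> flotw e v la'.
Proof.
move=> fla hd [a0 cl U] ap; have [gw Ag _ _] := reduced_addable fla hd.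
have [bE lt] : b = (part la c a).+1 /\ ((a == 1) || (part la c a < part la c a.-1))%N.
  by move: Ag; rewrite addableE => /and4P[_ _ /eqP bE lt].
apply: (flotwI he hl hv ap) => d d' x x' dl d'l x1 x'1 tw.
have := flotw_dominates he hl hv fla dl d'l x1 (twin_dominates tw).
rewrite !U; case: (boolP ((d' == c) && (x' == a))) => [/andP[/eqP dc /eqP xa]|_]; last first.
  by case: ifP => // /andP[/eqP-> /eqP->] le; rewrite bE leqW.
rewrite {}dc {}xa in x'1 tw d'l *; case: ifP => [_ _ //|_ le].
case: x x1 tw le => [a'|//] a'1 tw le.
rewrite bE ltn_neqAle le andbT; apply/negP => /eqP pb.
(* The row above the twin row dominates the row above row [a], which is longer than row [a]. Hence
   the twin row, equal in length to row [a], has an addable node too. *)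
have up : (a' == 1)%N || (part la d a' < part la d a'.-1)%N.
  case: eqP => //= a'n; have := v_lt he hl hv cl dl => vv.
  have a1 : (1 < a)%N.
    case/orP: tw => [/andP[dc /eqP E]|/eqP E]; last by lia.
    have dcl : (d <= c < l)%N by lia.
    by have := v_le he hl hv dcl; lia.
  rewrite -pb; apply: leq_trans (_ : part la c a.-1 <= _)%N.
    by move: lt; have -> : (a == 1)%N = false by lia.
  by apply: (flotw_dominates he hl hv fla) => //; move: tw; rewrite /dominates /twin; lia.
have Ag' : addable la (a', b, d).
  by rewrite addableE dl bE pb eqxx up !andbT; lia.
have g'w : (a', b, d) \in ar_word v la i.
  rewrite mem_ar_word Ag' -(twin_residue b tw).
  by move: gw; rewrite mem_ar_word => /andP[].
apply: (no_addable_twin (@prec_trans _ v) (@prec_irr _ v) (ar_word_sorted _ _ _)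
  (ar_word_prec he hl hv fla) (@level_odd _ _ _ _ _) (@level_even _ _ _ _ _) hd g'w Ag').
  exact: twin_prec.
by rewrite /level !addable_notR.
Qed.

Lemma mpart_etP la i : flotw e v la ->
  mpart_et v i la = None /\ unmatched_rem v la i = 0%N \/
  exists la', [/\ mpart_et v i la = Some la', flotw e v la',
    mseg_ft i (fv e v la') = fv e v la & (0 < unmatched_rem v la i)%N].
Proof.
move=> fla; rewrite /mpart_et.
case hd: (ohead _) => [[[a b] c]|]; last first.
  by left; split=> //; rewrite /unmatched_rem -size_filter; case: filter hd.
have [gw Rg y0 lm _] := reduced_removable fla hd.
have [la' rE U] := remove_node_updates Rg.
have [a0 cl b0 bE] : [/\ 0 < a, c < l, 0 < b & b = part la c a]%N.
  by have [] := U; move: Rg; rewrite removableE => /and4P[_ b0 /eqP].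
have U' : updates la' a c b la.
  have [_ _ UE] := U; split=> // c' j; rewrite UE.
  by case: (boolP (_ && _)) => [/andP[/eqP-> /eqP->]|_].
have ri : rend e v c a b = i by move: gw; rewrite mem_ar_word => /andP[_ /eqP].
have g : grows i b (fv e v la') (fv e v la).
  rewrite -ri; apply: updates_grows => //.
  by have [_ _ ->] := U; rewrite !eqxx prednK.
(* Aperiodicity is obtained on multisegments and supplies the residue condition for [la']. *)
have ap := aperiodic_shrink (fv_aperiodic fla) g lm.
right; exists la'; split=> //; last exact: grows_last_min g lm.
exact: remove_flotw hd U ap.
Qed.

Lemma mpart_ftP la i : flotw e v la ->
  mpart_ft v i la = None /\ unmatched_add v la i = 0%N \/
  exists la', [/\ mpart_ft v i la = Some la', flotw e v la',
    fv e v la' = mseg_ft i (fv e v la), (0 < unmatched_add v la i)%N &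
    unmatched_add v la i = (unmatched_add v la' i).+1].
Proof.
move=> fla; rewrite /mpart_ft.
case hd: (ohead _) => [[[a b] c]|]; last first.
  left; split=> //; rewrite /unmatched_add -size_filter -size_rev.
  by case: rev hd.
have [gw Ag x0 Lb] := reduced_addable fla hd.
have [la' rE U] := add_node_updates Ag.
have bE : b = (part la c a).+1 by move: Ag; rewrite addableE => /and4P[_ _ /eqP].
have ri : rend e v c a b = i by move: gw; rewrite mem_ar_word => /andP[_ /eqP].
have g := updates_grows e v U bE; rewrite ri in g.
have fE : fv e v la' = mseg_ft i (fv e v la).
  by apply: grows_uniq g _; rewrite -Lb; exact: grows_ft.
have ap : aperiodic (fv e v la') by rewrite fE; apply/aperiodic_ft/fv_aperiodic.
have fla' := add_flotw fla hd U ap.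
right; exists la'; split=> //.
(* The number of unmatched A is that of unmatched R plus the pairing of the weight. The former
   summand grows by 1 and the latter drops by 2. *)
have eps1 := mseg_eps_ft i (fv e v la); rewrite -fE !mseg_eps_fv // in eps1.
have dif := unmatched_diff v la i; have dif' := unmatched_diff v la' i.
suff pE : pairing (mpart_wt e v la') i = pairing (mpart_wt e v la) i - 2.
  rewrite pE -dif eps1 in dif'; move: dif'.
  move: (unmatched_add _ _ _) (unmatched_add _ _ _) (unmatched_rem _ _ _) => x x' y.
  move=> d; have {}d : x'%:Z - (y%:Z + 1) = x%:Z - y%:Z - 2 :> int by exact: d.
  lia.
pose N := (nrows la + nrows la' + a).+1.
have [N1 N2 N3] : [/\ nrows la < N, nrows la' < N & a < N]%N by rewrite /N; split; lia.
rewrite !fv_wt (pairing_sum v i N1) (pairing_sum v i N2) (rowsum_updates _ U N3).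
have rE' : rend e v c a (part la c a) = i - 1.
  by rewrite -ri bE rendS addrK.
rewrite {2 3}/end_term ri rE' [i == _ - 1]eq_sym pred_neq !eqxx !leq0n /=; ring.
Qed.

End CrystalOperators.

(** * The embedding and its uniqueness *)

Section MaxIter.
Local Open Scope classical_set_scope.

Lemma max_iter_omap (T U : Type) (f : T -> U) (g : T -> option T) (h : U -> option U) :
  (forall x, h (f x) = omap f (g x)) -> forall x, max_iter h (f x) = max_iter g x.
Proof.
move=> hf x.
have iterE k : iter k (obind h) (Some (f x)) = omap f (iter k (obind g) (Some x)).
  by elim: k => //= k ->; case: (iter k _ _) => //=.
have nzE k : (iter k (obind h) (Some (f x)) <> None) =
             (iter k (obind g) (Some x) <> None).
  by rewrite iterE; apply/propext; case: (iter k _ _).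
rewrite /max_iter; congr xget; apply/funext => k; rewrite /mkset nzE.
congr (_ /\ _); apply/propext.
by split=> H m; have := H m; rewrite nzE.
Qed.

(** Applied with [d] the number of unmatched letters, which each operator lowers by one and which is
    0 where the operator vanishes. *)
Lemma max_iter_grade (T : Type) (g : T -> option T) (d : T -> nat) :
  (forall x, g x = None -> d x = 0%N) -> (forall x y, g x = Some y -> d x = (d y).+1) ->
  forall x, max_iter g x = d x.
Proof.
move=> d0 dS x.
have nz k y : (iter k (obind g) (Some y) <> None) <-> (k <= d y)%N.
  elim: k y => [|k IH] y; first by [].
  rewrite iterSr /=; case gy: (g y) => [z|]; first by rewrite (dS _ _ gy) ltnS; exact: IH.
  have -> : iter k (obind g) None = None by elim: (k) => //= m ->.
  by rewrite (d0 _ gy) ltn0.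
rewrite /max_iter; apply: xget_unique => /=; first by split=> [|m /nz//]; apply/nz.
by move=> k [/nz kd /(_ (d x))] H; apply/eqP; rewrite eqn_leq kd H //; apply/nz.
Qed.

End MaxIter.

(** Provides the measure for the induction in the uniqueness proof. *)
Lemma grows_size e (i : 'Z_e) k (psi psi' : {mset seq 'Z_e}) : grows i k psi psi' ->
  size (flatten psi') = (size (flatten psi)).+1.
Proof.
case=> k0 E; set t := if (1 < k)%N then [:: seg_to k.-1 (i - 1)] else [::].
have /perm_flatten/perm_size : perm_eq (psi' ++ t) (seg_to k i :: psi).
  apply/allP => x _ /=.
  have tE : count_mem x t = (1 < k)%N && (x == seg_to k.-1 (i - 1)) :> nat.
    by rewrite /t; case: (1 < k)%N; rewrite //= addn0 eq_sym.
  by rewrite count_cat !count_mem_mset tE E addnC [x == _]eq_sym.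
rewrite flatten_cat size_cat /= size_cat size_seg /t.
by case: (ltnP 1 k) => k1; rewrite /= ?cats0 ?size_seg; lia.
Qed.

Lemma Binf_ft_inj e (i : 'Z_e) : injective (@Binf_ft e i).
Proof. by move=> x y /(congr1 val) /mseg_ft_inj/val_inj. Qed.

Lemma Binf_et_ft e (i : 'Z_e) psi : Binf_et i (Binf_ft i psi) = Some psi.
Proof.
rewrite /Binf_et; case: pselect => [ex|[]]; last by exists psi.
by congr Some; apply: (@Binf_ft_inj _ i); exact: proj2_sig (cid ex).
Qed.

Lemma Binf_ft_et e (i : 'Z_e) psi psi' : Binf_et i psi = Some psi' -> Binf_ft i psi' = psi.
Proof.
by rewrite /Binf_et; case: pselect => // ex [<-]; exact: proj2_sig (cid ex).
Qed.

(** If [psi] were the image of some [psi'], its [mseg_eps] would be one more than a nonnegative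
    number. *)
Lemma Binf_et_None e (i : 'Z_e) psi : mseg_eps (val psi) i = 0 -> Binf_et i psi = None.
Proof.
case E: (Binf_et i psi) => [psi'|] //; rewrite -(Binf_ft_et E).
rewrite /= mseg_eps_ft => eps0; have := mseg_eps_ge0 (val psi') i.
by rewrite -(lerD2r 1) eps0 add0r ler10.
Qed.

Section Embedding.
Variables (e l : nat) (v : l.-tuple int).
Hypotheses (he : (2 <= e)%N) (hl : (0 < l)%N) (hv : in_V e v).
Implicit Types (la : mpart l) (i : 'Z_e) (b : Phi e v).

Definition start_count (s : 'Z_e) k la N : int :=
  rowsum (fun c a m => [&& (0 < k)%N, (k <= m)%N & (1 - a%:Z + v`_c)%:~R == s]%:Z) la N.

Lemma start_countE s k la N : (nrows la < N)%N -> start_count s k la N =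
  \sum_(x <- (fv e v la : seq _)) [&& (0 < k)%N, (k <= size x)%N & nth 0 x 0 == s]%:Z.
Proof.
move=> MN; rewrite (sum_fv v _ MN); apply: eq_bigr => c _; apply: eq_bigr => a _.
case: (part la c a) => [|m]; first by case: k.
by rewrite -[m.+1 == 0%N]/false /rseg size_seg nth_mkseq // addr0.
Qed.

(** If row [a] of component [c] has length [k] in [mu] and less in [mu'], then [mu] has more rows of
    length at least [k] starting at its first residue than [mu']. But [start_countE] reads that
    number off the multisegment. *)
Lemma fv_inj la la' : flotw e v la -> flotw e v la' -> fv e v la = fv e v la' -> la = la'.
Proof.
move=> fla fla' E.
suff le mu mu' c a : flotw e v mu -> flotw e v mu' -> fv e v mu = fv e v mu' ->
    (c < l)%N -> (0 < a)%N -> (part mu c a <= part mu' c a)%N.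
  by apply: mpart_ext => c a cl a0; apply/eqP; rewrite eqn_leq !le.
move=> {fla fla' E la la'} fmu fmu' E cl a0; rewrite leqNgt; apply/negP => lt.
set k := part mu c a in lt; set s : 'Z_e := (1 - a%:Z + v`_c)%:~R.
pose N := (nrows mu + nrows mu' + a).+1.
have [N1 N2 N3] : [/\ nrows mu < N, nrows mu' < N & a < N]%N by rewrite /N; split; lia.
have : start_count s k mu N - start_count s k mu' N = 0.
  by rewrite !start_countE // E subrr.
rewrite /start_count /rowsum -sumrB.
under eq_bigr do rewrite -sumrB.
pose G (c' a' : nat) : int :=
  [&& (0 < k)%N, (k <= part mu c' a')%N & (1 - a'%:Z + v`_c')%:~R == s]%:Z -
  [&& (0 < k)%N, (k <= part mu' c' a')%N & (1 - a'%:Z + v`_c')%:~R == s]%:Z.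
rewrite -[X in X = 0]/(\sum_(0 <= c' < l) \sum_(1 <= a' < N) G c' a').
(* A row counted for [mu'] is comparable with row [a] of [c] and cannot be dominated by it, so it
   dominates it and is counted for [mu] as well. *)
have G0 c' a' : 0 <= G c' a'.
  rewrite /G subr_ge0 lez_nat; case: (_ == s) / eqP => [sE|_]; rewrite ?andbF // !andbT.
  have k0 : (0 < k)%N by lia.
  rewrite k0 /=; case: (leqP k (part mu' c' a')) => // kp.
  have [a'0 c'l _] := part_gt0 (leq_trans k0 kp).
  suff -> : (k <= part mu c' a')%N by [].
  have [dom|dom] : dominates e v c a c' a' \/ dominates e v c' a' c a.
    by have := Zint_eq he hl sE; rewrite /dominates; lia.
    have := flotw_dominates he hl hv fmu' cl c'l _ dom; lia.
  by apply: (flotw_dominates he hl hv fmu c'l cl _ dom); lia.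
move/eqP; rewrite psumr_eq0; last by move=> c' _; apply: sumr_ge0.
move/allP/(_ c); rewrite mem_index_iota cl /= => /(_ isT).
rewrite psumr_eq0; last by move=> a' _.
move/allP/(_ a); rewrite mem_index_iota a0 N3 /= => /(_ isT).
rewrite /G eqxx leqnn !andbT; have -> : (k <= part mu' c a)%N = false by lia.
by rewrite andbF; have -> : (0 < k)%N by lia.
Qed.

Lemma flotwP b : flotw e v (val b).
Proof. exact: asboolW (valP b). Qed.

(** By stability of the FLOTW conditions, [insub] never turns a nonzero value into 0. *)
Lemma val_et i b : mpart_et v i (val b) = omap val (et i b).
Proof.
rewrite /=; have [[-> _]//|[la' [-> fla' _ _]]] := mpart_etP he hl hv i (flotwP b).
by rewrite /= insubT; [exact: asboolT|].
Qed.

Lemma val_ft i b : mpart_ft v i (val b) = omap val (ft i b).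
Proof.
rewrite /=; have [[-> _]//|[la' [-> fla' _ _ _]]] := mpart_ftP he hl hv i (flotwP b).
by rewrite /= insubT; [exact: asboolT|].
Qed.

Definition mseg_of b : aperiodic_mseg e := (Phi_emb b).1.

Lemma val_mseg_of b : val (mseg_of b) = fv e v (val b).
Proof. by []. Qed.

Lemma et_mseg_of i b : Binf_et i (mseg_of b) = omap mseg_of (et i b).
Proof.
have := val_et i b; have [[-> y0]|[la' [-> fla' E _]]] := mpart_etP he hl hv i (flotwP b).
  case: (et i b) => // _; apply: Binf_et_None.
  by rewrite val_mseg_of (mseg_eps_fv he hl hv) ?y0 //; exact: flotwP.
case: (et i b) => //= b' [bE].
rewrite -(Binf_et_ft i (mseg_of b')); congr Binf_et; apply: val_inj.
by rewrite /= -bE E.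
Qed.

Lemma ft_mseg_of i b b' : ft i b = Some b' -> Binf_ft i (mseg_of b) = mseg_of b'.
Proof.
move=> ftb; have := val_ft i b; rewrite ftb.
have [[-> _]//|[la' [-> fla' E _ _]] /= [bE]] := mpart_ftP he hl hv i (flotwP b).
by apply: val_inj; rewrite /= -bE E.
Qed.

Lemma max_iter_et i b : max_iter (mpart_et v i) (val b) = unmatched_rem v (val b) i.
Proof.
rewrite (max_iter_omap (g := et i)); last exact: val_et.
apply: (max_iter_grade (d := fun b => unmatched_rem v (val b) i)) => {}b => [|b'] Eb;
  have := val_et i b; rewrite Eb.
  by have [[_ ->]//|[la' [-> _ _ _]]] := mpart_etP he hl hv i (flotwP b).
have [[-> _]//|[la' [-> fla' E _]] /= [bE]] := mpart_etP he hl hv i (flotwP b).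
have := mseg_eps_ft i (fv e v la').
rewrite E (mseg_eps_fv he hl hv i (flotwP b)) (mseg_eps_fv he hl hv i fla') bE.
by move/eqP; rewrite -PoszD eqz_nat addn1 => /eqP.
Qed.

Lemma max_iter_ft i b : max_iter (mpart_ft v i) (val b) = unmatched_add v (val b) i.
Proof.
rewrite (max_iter_omap (g := ft i)); last exact: val_ft.
apply: (max_iter_grade (d := fun b => unmatched_add v (val b) i)) => {}b => [|b'] Eb;
  have := val_ft i b; rewrite Eb.
  by have [[_ ->]//|[la' [-> _ _ _ _]]] := mpart_ftP he hl hv i (flotwP b).
by have [[-> _]//|[la' [-> _ _ _ ->]] /= [->]] := mpart_ftP he hl hv i (flotwP b).
Qed.

Lemma Binf_eps_mseg_of i b : Binf_eps i (mseg_of b) = (unmatched_rem v (val b) i)%:Z.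
Proof.
rewrite /Binf_eps (max_iter_omap (g := et i)); last exact: et_mseg_of.
by rewrite -max_iter_et (max_iter_omap (g := et i)) //; exact: val_et.
Qed.

Lemma Phi_emb_embedding : crystal_embedding (@Phi_emb e l v).
Proof.
split.
- move=> b b' [E]; apply/val_inj/fv_inj => //; exact: flotwP.
- by move=> b; rewrite /= fv_wt.
- move=> i b /=; rewrite -/(mseg_of b) Binf_eps_mseg_of max_iter_et.
  by rewrite maxeNy.
- move=> i b /=; rewrite -/(mseg_of b) Binf_eps_mseg_of max_iter_ft maxNye.
  rewrite -EFinD; congr EFin.
  have := unmatched_diff v (val b) i; rewrite fv_wt.
  have -> : forall w w' : weight e, pairing (w + w') i = pairing w i + pairing w' i.
    by move=> w w'; rewrite /pairing ffunE.
  by move=> dif; rewrite -addrA -dif; ring.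
- move=> i b /=; rewrite -/(mseg_of b) leNye et_mseg_of.
  by rewrite -[obind _ _]/(et i b); case: (et i b).
- move=> i b b' /ft_mseg_of E /=; rewrite -/(mseg_of b) ltNyr E.
  by [].
Qed.

Lemma tensor_T_ext (x y : tensor (Binf e) (T_crystal (Lambda e v))) :
  x.1 = y.1 -> x = y.
Proof. by case: x y => [x []] [y []] /= ->. Qed.

Lemma Phi_emb_unique (h : Phi e v -> tensor (Binf e) (T_crystal (Lambda e v))) :
  crystal_embedding h -> forall b, h b = Phi_emb b.
Proof.
move=> hE b; have [n] := ubnP (size (flatten (fv e v (val b)))).
elim: n b => // n IH b; rewrite ltnS => bn; apply: tensor_T_ext.
have hemb (f : Phi e v -> tensor (Binf e) (T_crystal (Lambda e v))) i :
    crystal_embedding f -> Binf_et i (f b).1 = omap (fun b' => (f b').1) (et i b).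
  move=> /emb_et /(_ i b) /=; rewrite leNye.
  by rewrite -[obind _ _]/(et i b); case: (Binf_et _ _) (et i b) => [x|] [y|] //= [<-].
have [fv0|] := eqVneq (fv e v (val b)) mset0.
  (* Only the preservation of weights is used here: the empty multisegment is the only one of weight
     0. *)
  have wtE : mseg_wt (val (h b).1) = 0.
    apply: (addIr (Lambda e v)); have := emb_wt hE b; rewrite /= => ->.
    by rewrite fv_wt fv0 /mseg_wt big_mset0 oppr0.
  apply: val_inj; rewrite /= fv0.
  by apply: mseg_wt_eq0 wtE; have [] := asboolW (valP (h b).1).
(* For a nonempty multisegment some unmatched R exists, so one can descend along this [i]. *)
move/(mseg_eps_gt0 (fv_aperiodic (flotwP b))) => [i].
rewrite (mseg_eps_fv he hl hv); last exact: flotwP.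
have vE := val_et i b.
have [[_ ->]//|[la' [E fla' fE _ _]]] := mpart_etP he hl hv i (flotwP b).
move: vE; rewrite E; case Eb: (et i b) => [b'|] //= [la'E].
have hb' : h b' = Phi_emb b'.
  apply: IH; apply: leq_trans bn; rewrite -fE la'E.
  by rewrite (grows_size (grows_ft i _)).
(* Both images of [b] are sent by [Binf_et] to the same element, and [Binf_ft] recovers them from
   it. *)
have h1 := hemb h i hE; have h2 := hemb _ i Phi_emb_embedding.
rewrite Eb /= hb' in h1; rewrite Eb /= in h2.
by rewrite -(Binf_ft_et h1) -(Binf_ft_et h2).
Qed.

End Embedding.

Theorem theorem5p11 (e l : nat) (v : l.-tuple int)
    (he : (2 <= e)%N) (hl : (0 < l)%N) (hv : in_V e v) :
  crystal_embedding (@Phi_emb e l v) /\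
  (forall h : Phi e v -> tensor (Binf e) (T_crystal (Lambda e v)),
     crystal_embedding h -> forall la, h la = Phi_emb la).
Proof. by split=> [|h]; [exact: Phi_emb_embedding|exact: Phi_emb_unique]. Qed.
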